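(* For $\delta\ge 0$, two p.f.d. persistence modules $M$ and $N$ are $\delta$-interleaved if and only if their barcodes $\mathcal B(M)$ and $\mathcal B(N)$ are $\delta$-interleaved. In particular, $$d_I(M,N)=d_I(\mathcal B(M),\mathcal B(N)).$$
   Context: Fix a field $K$. $\mathbf{vect}$ is the category of finite dimensional $K$-vector spaces, $\mathbf R$ the poset category of real numbers. A pointwise finite dimensional (p.f.d.) persistence module is an object of the functor category $\mathbf{vect}^{\mathbf R}$. An interval is a non-empty set $I\subseteq\mathbb R$ such that $a,c\in I$ and $a<b<c$ imply $b\in I$. A barcode is a multiset representation of intervals: a subset of $S\times X$ where $S$ is a set of intervals and $X$ is any set (of indices). An element $(I,x)$ is usually written simply $I$. A barcode is natural if $X=\mathbb N=\{1,2,\dots\}$ and for each $I$ the set of its indices is a prefix of $\mathbb N$. For a p.f.d. persistence module $M$, $\mathcal B(M)$ denotes the unique natural barcode with $M\cong\bigoplus_{I\in\mathcal B(M)}K^I$ (it exists by the structure theorem), where the interval module $K^I$ is $K$ at indices in $I$, $0$ elsewhere, with identity internal maps between indices in $I$. For intervals $I,J$: $I$ overlaps $J$ above if $I\cap J\neq\emptyset$, for all $s\in J$ there is $t\in I$ with $s\le t$, and for all $t\in I$ there is $s\in J$ with $s\le t$. An overlap matching $\sigma:\mathcal C\to\mathcal D$ of barcodes is a matching (partial injective function) such that $\sigma(I)=J$ implies that $I$ overlaps $J$ above. $\mathbf{Barc}$ is the category of barcodes and overlap matchings with composition $\tau\bullet\sigma=\{(I,K)\in\tau\circ\sigma\mid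 I\text{ overlaps }K\text{ above}\}$, where $\tau\circ\sigma$ is composition of relations. Interleavings of persistence modules: for $\delta\in\mathbb R$ and $M:\mathbf R\to\mathbf{vect}$, $M(\delta)$ is the shifted module with $M(\delta)_t=M_{t+\delta}$ and correspondingly shifted internal maps; a morphism $f:M\to N$ induces $f(\delta):M(\delta)\to N(\delta)$. For $\delta\ge0$, $S^{M,\delta}:M\to M(\delta)$ is the morphism with components $M_{t,t+\delta}$. A $\delta$-interleaving between $M$ and $N$ is a pair of morphisms $f:M\to N(\delta)$, $g:N\to M(\delta)$ with $g(\delta)\circ f=S^{M,2\delta}$ and $f(\delta)\circ g=S^{N,2\delta}$. Interleavings of barcodes: for an interval $I$, $I(\delta)=\{t\mid t+\delta\in I\}$; for a barcode $\mathcal C$, $\mathcal C(\delta)=\{I(\delta)\mid I\in\mathcal C\}$ (with the same indices); an overlap matching $f:\mathcal C\to\mathcal D$ induces $f(\delta):\mathcal C(\delta)\to\mathcal D(\delta)$. For $\delta\ge0$, $S^{\mathcal C,\delta}:\mathcal C\to\mathcal C(\delta)$ is the overlap matching $\{(I,I(\delta))\mid I\in\mathcal C\text{ is not contained in any half-open interval of length }\delta\}$. A $\delta$-interleaving between barcodes $\mathcal C,\mathcal D$ is a pair of overlap matchings $f:\mathcal C\to\mathcal D(\delta)$, $g:\mathcal D\to\mathcal C(\delta)$ with $g(\delta)\bullet f=S^{\mathcal C,2\delta}$ and $f(\delta)\bullet g=S^{\mathcal D,2\delta}$. In either setting, two objects are $\delta$-interleaved if there is a $\delta$-interleaving between them,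 and $d_I$ of two objects is the infimum of all $\delta\ge0$ such that they are $\delta$-interleaved (with $\inf\emptyset=\infty$). *)

(* Defs.v *)
From HB Require Import structures.
From mathcomp Require Import all_boot all_order all_algebra.
From mathcomp Require Import all_classical all_reals.
From mathcomp Require Import ereal normedtype.

Set Implicit Arguments.
Unset Strict Implicit.
Unset Printing Implicit Defensive.

Import Order.TTheory GRing.Theory Num.Theory.

Local Open Scope classical_set_scope.
Local Open Scope ring_scope.

(** * Persistence modules *)

(* Functors from the poset (R, <=) to K-vector spaces of any dimension: the
   direct sum of an arbitrary barcode must live somewhere before one can say
   that a pointwise finite dimensional module is isomorphic to it. *)
Record pmodule (R : realType) (K : fieldType) := PModule {
  pobj :> R -> lmodType K;
  pmap : forall s t : R, s <= t -> {linear pobj s -> pobj t};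
  pmap_id : forall (t : R) (h : t <= t) (x : pobj t), pmap h x = x;
  pmap_comp : forall (s t u : R) (hst : s <= t) (htu : t <= u) (hsu : s <= u)
    (x : pobj s), pmap hsu x = pmap htu (pmap hst x)
}.

Arguments pmap {R K} p {s t} _.

(* Objects of the functor category vect^R; [vectType K] is the type of finite
   dimensional K-vector spaces. *)
Record pfd_module (R : realType) (K : fieldType) := PfdModule {
  pfd_obj : R -> vectType K;
  pfd_map : forall s t : R, s <= t -> {linear pfd_obj s -> pfd_obj t};
  pfd_map_id : forall (t : R) (h : t <= t) (x : pfd_obj t), pfd_map h x = x;
  pfd_map_comp : forall (s t u : R) (hst : s <= t) (htu : t <= u)
    (hsu : s <= u) (x : pfd_obj s),
    pfd_map hsu x = pfd_map htu (pfd_map hst x)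
}.

(* vect^R is a full subcategory, so morphisms, isomorphisms and interleavings
   are only defined for [pmodule]. *)
Definition pmodule_of_pfd (R : realType) (K : fieldType)
    (M : pfd_module R K) : pmodule R K :=
  @PModule R K (fun t => pfd_obj M t) (@pfd_map R K M)
    (@pfd_map_id R K M) (@pfd_map_comp R K M).

Coercion pmodule_of_pfd : pfd_module >-> pmodule.

Record pmorphism (R : realType) (K : fieldType) (M N : pmodule R K) :=
  PMorphism {
    pmor :> forall t : R, {linear M t -> N t};
    pmor_natural : forall (s t : R) (h : s <= t) (x : M s),
      pmor t (pmap M h x) = pmap N h (pmor s x)
  }.

Definition pmor_eq (R : realType) (K : fieldType) (M N : pmodule R K)
    (f g : pmorphism M N) : Prop :=
  forall t : R, f t =1 g t.

Lemma pmor_id_natural (R : realType) (K : fieldType) (M : pmodule R K)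
    (s t : R) (h : s <= t) (x : M s) :
  (idfun : {linear M t -> M t}) (pmap M h x) =
  pmap M h ((idfun : {linear M s -> M s}) x).
Proof. by []. Qed.

Definition pmor_id (R : realType) (K : fieldType) (M : pmodule R K) :
    pmorphism M M :=
  @PMorphism R K M M (fun t => idfun : {linear M t -> M t})
    (@pmor_id_natural R K M).

Lemma pmor_comp_natural (R : realType) (K : fieldType) (M N P : pmodule R K)
    (g : pmorphism N P) (f : pmorphism M N) (s t : R) (h : s <= t) (x : M s) :
  (g t \o f t) (pmap M h x) = pmap P h ((g s \o f s) x).
Proof. by rewrite /= !pmor_natural. Qed.

Definition pmor_comp (R : realType) (K : fieldType) (M N P : pmodule R K)
    (g : pmorphism N P) (f : pmorphism M N) : pmorphism M P :=
  @PMorphism R K M P (fun t => g t \o f t : {linear M t -> P t})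
    (pmor_comp_natural g f).

Definition pisomorphic (R : realType) (K : fieldType) (M N : pmodule R K) :
    Prop :=
  exists (f : pmorphism M N) (g : pmorphism N M),
    pmor_eq (pmor_comp g f) (pmor_id M) /\ pmor_eq (pmor_comp f g) (pmor_id N).

(** ** Shifts and interleavings *)

Lemma le_shift (R : realType) (d s t : R) : s <= t -> s + d <= t + d.
Proof. by rewrite lerD2r. Qed.

Lemma pshift_id (R : realType) (K : fieldType) (d : R) (M : pmodule R K)
    (t : R) (h : t <= t) (x : M (t + d)) : pmap M (le_shift d h) x = x.
Proof. exact: pmap_id. Qed.

Lemma pshift_comp (R : realType) (K : fieldType) (d : R) (M : pmodule R K)
    (s t u : R) (hst : s <= t) (htu : t <= u) (hsu : s <= u) (x : M (s + d)) :
  pmap M (le_shift d hsu) x =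
  pmap M (le_shift d htu) (pmap M (le_shift d hst) x).
Proof. exact: pmap_comp. Qed.

Definition pshift (R : realType) (K : fieldType) (d : R) (M : pmodule R K) :
    pmodule R K :=
  @PModule R K (fun t => M (t + d)) (fun s t h => pmap M (le_shift d h))
    (@pshift_id R K d M) (@pshift_comp R K d M).

Lemma pmor_shift_natural (R : realType) (K : fieldType) (d : R)
    (M N : pmodule R K) (f : pmorphism M N) (s t : R) (h : s <= t)
    (x : pshift d M s) :
  f (t + d) (pmap (pshift d M) h x) = pmap (pshift d N) h (f (s + d) x).
Proof. exact: pmor_natural. Qed.

Definition pmor_shift (R : realType) (K : fieldType) (d : R)
    (M N : pmodule R K) (f : pmorphism M N) :
    pmorphism (pshift d M) (pshift d N) :=
  @PMorphism R K (pshift d M) (pshift d N) (fun t => f (t + d))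
    (@pmor_shift_natural R K d M N f).

Lemma le_addshift (R : realType) (d : R) (hd : 0 <= d) (t : R) : t <= t + d.
Proof. by rewrite lerDl. Qed.

Lemma ptransition_natural (R : realType) (K : fieldType) (M : pmodule R K)
    (d : R) (hd : 0 <= d) (s t : R) (h : s <= t) (x : M s) :
  pmap M (le_addshift hd t) (pmap M h x) =
  pmap (pshift d M) h (pmap M (le_addshift hd s) x).
Proof.
have hs : s <= t + d := le_trans h (le_addshift hd t).
by rewrite -(pmap_comp _ _ hs) /= -(pmap_comp _ _ hs).
Qed.

(* S^{M,d} *)
Definition ptransition (R : realType) (K : fieldType) (M : pmodule R K) (d : R)
    (hd : 0 <= d) : pmorphism M (pshift d M) :=
  @PMorphism R K M (pshift d M) (fun t => pmap M (le_addshift hd t))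
    (@ptransition_natural R K M d hd).

Lemma le_shift_add (R : realType) (d e t : R) : t + e + d <= t + (d + e).
Proof. by rewrite -addrA [e + d]addrC. Qed.

Lemma pshift_add_natural (R : realType) (K : fieldType) (M : pmodule R K)
    (d e s t : R) (h : s <= t) (x : pshift e (pshift d M) s) :
  pmap M (le_shift_add d e t) (pmap (pshift e (pshift d M)) h x) =
  pmap (pshift (d + e) M) h (pmap M (le_shift_add d e s) x).
Proof.
have hs : s + e + d <= t + (d + e).
  exact: le_trans (le_shift_add d e s) (le_shift (d + e) h).
by rewrite -(pmap_comp _ _ hs) /= -(pmap_comp _ _ hs).
Qed.

(* The identification M(d)(e) = M(d + e).  The indices t + e + d and
   t + (d + e) are equal but not convertible, so its components are the
   internal maps of M between them, which are transported identities. *)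
Definition pshift_add (R : realType) (K : fieldType) (M : pmodule R K)
    (d e : R) : pmorphism (pshift e (pshift d M)) (pshift (d + e) M) :=
  @PMorphism R K (pshift e (pshift d M)) (pshift (d + e) M)
    (fun t => pmap M (le_shift_add d e t)) (@pshift_add_natural R K M d e).

Definition is_pinterleaving (R : realType) (K : fieldType) (M N : pmodule R K)
    (d : R) (hd : 0 <= d)
    (f : pmorphism M (pshift d N)) (g : pmorphism N (pshift d M)) : Prop :=
  pmor_eq
    (pmor_comp (pshift_add M d d) (pmor_comp (pmor_shift d g) f))
    (ptransition M (addr_ge0 hd hd)) /\
  pmor_eq
    (pmor_comp (pshift_add N d d) (pmor_comp (pmor_shift d f) g))
    (ptransition N (addr_ge0 hd hd)).

Definition pinterleaved (R : realType) (K : fieldType) (M N : pmodule R K)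
    (d : R) : Prop :=
  exists (hd : 0 <= d) (f : pmorphism M (pshift d N))
    (g : pmorphism N (pshift d M)), is_pinterleaving hd f g.

Definition pdist (R : realType) (K : fieldType) (M N : pmodule R K) : \bar R :=
  ereal_inf [set d%:E | d in [set d : R | 0 <= d /\ pinterleaved M N d]].

(** ** Direct sums *)

(* Direct sum of an arbitrary family of vector spaces: dependent functions of
   finite support. *)
Record dsum (K : fieldType) (T : Type) (V : T -> lmodType K) := DSum {
  dsum_fun :> forall i : T, V i;
  dsum_finite : finite_set [set i | dsum_fun i <> 0]
}.

Lemma dsum_eq (K : fieldType) (T : Type) (V : T -> lmodType K)
    (x y : dsum V) : (forall i, x i = y i) -> x = y.
Proof.
case: x y => [x hx] [y hy] /= xy.
have {xy} exy : x = y by apply: functional_extensionality_dep.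
by subst y; congr DSum; exact: Prop_irrelevance.
Qed.

Lemma dsum_zero_finite (K : fieldType) (T : Type) (V : T -> lmodType K) :
  finite_set [set i | (0 : V i) <> 0].
Proof.
suff -> : [set i | (0 : V i) <> 0] = set0 by exact: finite_set0.
by rewrite -subset0 => i /=; apply.
Qed.

Lemma dsum_opp_finite (K : fieldType) (T : Type) (V : T -> lmodType K)
    (x : dsum V) : finite_set [set i | - x i <> 0].
Proof.
apply: sub_finite_set (dsum_finite x) => i /= xi0 xi.
by apply: xi0; rewrite xi oppr0.
Qed.

Lemma dsum_add_finite (K : fieldType) (T : Type) (V : T -> lmodType K)
    (x y : dsum V) : finite_set [set i | x i + y i <> 0].
Proof.
have : finite_set ([set i | x i <> 0] `|` [set i | y i <> 0]).
  by rewrite finite_setU; split; exact: dsum_finite.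
apply: sub_finite_set => i /= xyi.
have [xi|xi] := pselect (x i = 0); [right=> yi|by left].
by apply: xyi; rewrite xi yi addr0.
Qed.

Lemma dsum_scale_finite (K : fieldType) (T : Type) (V : T -> lmodType K)
    (a : K) (x : dsum V) : finite_set [set i | a *: x i <> 0].
Proof.
apply: sub_finite_set (dsum_finite x) => i /= xi0 xi.
by apply: xi0; rewrite xi scaler0.
Qed.

Definition dsum_zero (K : fieldType) (T : Type) (V : T -> lmodType K) :
  dsum V := DSum (@dsum_zero_finite K T V).
Definition dsum_opp (K : fieldType) (T : Type) (V : T -> lmodType K)
  (x : dsum V) : dsum V := DSum (dsum_opp_finite x).
Definition dsum_add (K : fieldType) (T : Type) (V : T -> lmodType K)
  (x y : dsum V) : dsum V := DSum (dsum_add_finite x y).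
Definition dsum_scale (K : fieldType) (T : Type) (V : T -> lmodType K)
  (a : K) (x : dsum V) : dsum V := DSum (dsum_scale_finite a x).

Lemma dsum_addA (K : fieldType) (T : Type) (V : T -> lmodType K) :
  associative (@dsum_add K T V).
Proof. by move=> x y z; apply: dsum_eq => i /=; exact: addrA. Qed.
Lemma dsum_addC (K : fieldType) (T : Type) (V : T -> lmodType K) :
  commutative (@dsum_add K T V).
Proof. by move=> x y; apply: dsum_eq => i /=; exact: addrC. Qed.
Lemma dsum_add0 (K : fieldType) (T : Type) (V : T -> lmodType K) :
  left_id (@dsum_zero K T V) (@dsum_add K T V).
Proof. by move=> x; apply: dsum_eq => i /=; exact: add0r. Qed.
Lemma dsum_addN (K : fieldType) (T : Type) (V : T -> lmodType K) :
  left_inverse (@dsum_zero K T V) (@dsum_opp K T V) (@dsum_add K T V).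
Proof. by move=> x; apply: dsum_eq => i /=; exact: addNr. Qed.

HB.instance Definition _ (K : fieldType) (T : Type) (V : T -> lmodType K) :=
  gen_eqMixin (dsum V).
HB.instance Definition _ (K : fieldType) (T : Type) (V : T -> lmodType K) :=
  gen_choiceMixin (dsum V).
HB.instance Definition _ (K : fieldType) (T : Type) (V : T -> lmodType K) :=
  GRing.isZmodule.Build (dsum V) (@dsum_addA K T V) (@dsum_addC K T V)
    (@dsum_add0 K T V) (@dsum_addN K T V).

Lemma dsum_scaleA (K : fieldType) (T : Type) (V : T -> lmodType K)
    (a b : K) (x : dsum V) :
  dsum_scale a (dsum_scale b x) = dsum_scale (a * b) x.
Proof. by apply: dsum_eq => i /=; exact: scalerA. Qed.
Lemma dsum_scale1 (K : fieldType) (T : Type) (V : T -> lmodType K) :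
  left_id 1 (@dsum_scale K T V).
Proof. by move=> x; apply: dsum_eq => i /=; exact: scale1r. Qed.
Lemma dsum_scaleDr (K : fieldType) (T : Type) (V : T -> lmodType K) :
  right_distributive (@dsum_scale K T V) +%R.
Proof. by move=> a x y; apply: dsum_eq => i /=; exact: scalerDr. Qed.
Lemma dsum_scaleDl (K : fieldType) (T : Type) (V : T -> lmodType K)
    (x : dsum V) (a b : K) :
  dsum_scale (a + b) x = dsum_scale a x + dsum_scale b x.
Proof. by apply: dsum_eq => i /=; exact: scalerDl. Qed.

HB.instance Definition _ (K : fieldType) (T : Type) (V : T -> lmodType K) :=
  GRing.Zmodule_isLmodule.Build K (dsum V) (@dsum_scaleA K T V)
    (@dsum_scale1 K T V) (@dsum_scaleDr K T V) (@dsum_scaleDl K T V).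

Lemma dsum_map_finite (K : fieldType) (T : Type) (V W : T -> lmodType K)
    (f : forall i, {linear V i -> W i}) (x : dsum V) :
  finite_set [set i | f i (x i) <> 0].
Proof.
apply: sub_finite_set (dsum_finite x) => i /= fxi xi.
by apply: fxi; rewrite xi linear0.
Qed.

Definition dsum_map (K : fieldType) (T : Type) (V W : T -> lmodType K)
    (f : forall i, {linear V i -> W i}) (x : dsum V) : dsum W :=
  DSum (dsum_map_finite f x).

Lemma dsum_map_linear (K : fieldType) (T : Type) (V W : T -> lmodType K)
    (f : forall i, {linear V i -> W i}) : linear (dsum_map f).
Proof. by move=> a x y; apply: dsum_eq => i /=; exact: linearP. Qed.

HB.instance Definition _ (K : fieldType) (T : Type) (V W : T -> lmodType K)
    (f : forall i, {linear V i -> W i}) :=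
  GRing.isLinear.Build K (dsum V) (dsum W) *:%R (dsum_map f)
    (dsum_map_linear f).

Lemma pdsum_id (R : realType) (K : fieldType) (T : Type)
    (M : T -> pmodule R K) (t : R) (h : t <= t) (x : dsum (fun i => M i t)) :
  dsum_map (fun i => pmap (M i) h) x = x.
Proof. by apply: dsum_eq => i /=; exact: pmap_id. Qed.

Lemma pdsum_comp (R : realType) (K : fieldType) (T : Type)
    (M : T -> pmodule R K) (s t u : R) (hst : s <= t) (htu : t <= u)
    (hsu : s <= u) (x : dsum (fun i => M i s)) :
  dsum_map (fun i => pmap (M i) hsu) x =
  dsum_map (fun i => pmap (M i) htu) (dsum_map (fun i => pmap (M i) hst) x).
Proof. by apply: dsum_eq => i /=; exact: pmap_comp. Qed.

Definition pdsum (R : realType) (K : fieldType) (T : Type)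
    (M : T -> pmodule R K) : pmodule R K :=
  @PModule R K (fun t => dsum (fun i => M i t))
    (fun s t h => dsum_map (fun i => pmap (M i) h))
    (@pdsum_id R K T M) (@pdsum_comp R K T M).

(** * Barcodes *)

Record ival (R : realType) := Ival {
  ival_set :> set R;
  ival_nonempty : ival_set !=set0;
  ival_interval : is_interval ival_set
}.

Definition barcode (R : realType) (X : Type) := set (ival R * X).

(** ** Interval modules and the barcode of a module *)

Definition kobj (K : fieldType) (b : bool) : lmodType K :=
  if b then (K^o : lmodType K) else ('rV[K]_0 : lmodType K).

Definition kmap (K : fieldType) (b c : bool) : {linear kobj K b -> kobj K c} :=
  match b, c with
  | true, true => idfun : {linear kobj K true -> kobj K true}
  | _, _ => \0%R : {linear _ -> _}
  end.

Lemma interval_module_id (R : realType) (K : fieldType) (I : ival R) (t : R)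
    (h : t <= t) (x : kobj K `[< ival_set I t >]) :
  kmap K `[< ival_set I t >] `[< ival_set I t >] x = x.
Proof. by case: `[< ival_set I t >] x => //= x; rewrite [RHS]thinmx0. Qed.

Lemma interval_module_comp (R : realType) (K : fieldType) (I : ival R)
    (s t u : R) (hst : s <= t) (htu : t <= u) (hsu : s <= u)
    (x : kobj K `[< ival_set I s >]) :
  kmap K `[< ival_set I s >] `[< ival_set I u >] x =
  kmap K `[< ival_set I t >] `[< ival_set I u >]
    (kmap K `[< ival_set I s >] `[< ival_set I t >] x).
Proof.
have : `[< ival_set I s >] -> `[< ival_set I u >] -> `[< ival_set I t >].
  move=> /asboolP Is /asboolP Iu; apply/asboolP.
  by apply: (ival_interval Is Iu); rewrite hst htu.
case: `[< ival_set I s >] x => x; case: `[< ival_set I u >];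
  case: `[< ival_set I t >] => //=.
by move=> /(_ isT isT).
Qed.

(* K^I *)
Definition interval_module (R : realType) (K : fieldType) (I : ival R) :
    pmodule R K :=
  @PModule R K (fun t => kobj K `[< ival_set I t >])
    (fun s t _ => kmap K `[< ival_set I s >] `[< ival_set I t >])
    (@interval_module_id R K I) (@interval_module_comp R K I).

Definition barcode_module (R : realType) (K : fieldType) (X : Type)
    (C : barcode R X) : pmodule R K :=
  pdsum (fun b : set_type C => interval_module K (val b).1).

(* The indices form a prefix of {1, 2, ...}, possibly empty or infinite. *)
Definition natural_barcode (R : realType) (C : barcode R nat) : Prop :=
  forall (I : ival R) (n : nat), C (I, n) ->
    (1 <= n)%N /\ forall m : nat, (1 <= m <= n)%N -> C (I, m).

(* The natural barcode B(M), as a definite description: existence is the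
   structure theorem for pointwise finite dimensional modules, uniqueness is
   the Krull-Schmidt-Azumaya theorem.  The default value [set0] of [xget] is
   only taken if there is no such barcode. *)
Definition barcode_of (R : realType) (K : fieldType) (M : pfd_module R K) :
    barcode R nat :=
  xget set0 [set C : barcode R nat |
    natural_barcode C /\ pisomorphic M (barcode_module K C)].

(** ** Overlap matchings *)

Definition overlaps_above (R : realType) (I J : ival R) : Prop :=
  [/\ I `&` J !=set0,
      forall s, ival_set J s -> exists2 t, ival_set I t & s <= t &
      forall t, ival_set I t -> exists2 s, ival_set J s & s <= t].

(* A relation between bars, encoded by its graph. *)
Definition bar_relation (R : realType) (X Y : Type) :=
  set ((ival R * X) * (ival R * Y)).

Definition matching (R : realType) (X Y : Type) (C : barcode R X)
    (D : barcode R Y) (f : bar_relation R X Y) : Prop :=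
  [/\ f `<=` C `*` D,
      forall b c c', f (b, c) -> f (b, c') -> c = c' &
      forall b b' c, f (b, c) -> f (b', c) -> b = b'].

Definition overlap_matching (R : realType) (X Y : Type) (C : barcode R X)
    (D : barcode R Y) (f : bar_relation R X Y) : Prop :=
  matching C D f /\ forall b c, f (b, c) -> overlaps_above b.1 c.1.

Definition overlap_comp (R : realType) (X Y Z : Type)
    (g : bar_relation R Y Z) (f : bar_relation R X Y) : bar_relation R X Z :=
  (g \; f)%relation `&` [set p | overlaps_above p.1.1 p.2.1].

(** ** Shifts and interleavings of barcodes *)

Lemma ival_shift_nonempty (R : realType) (d : R) (I : ival R) :
  [set t | ival_set I (t + d)] !=set0.
Proof.
by case: (ival_nonempty I) => t It; exists (t - d); rewrite /= subrK.
Qed.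

Lemma ival_shift_interval (R : realType) (d : R) (I : ival R) :
  is_interval [set t | ival_set I (t + d)].
Proof.
move=> x y /= Ix Iy z /andP[xz zy].
by apply: (ival_interval Ix Iy); rewrite !lerD2r xz zy.
Qed.

Definition ival_shift (R : realType) (d : R) (I : ival R) : ival R :=
  Ival (ival_shift_nonempty d I) (@ival_shift_interval R d I).

Definition bar_shift (R : realType) (X : Type) (d : R) (b : ival R * X) :
  ival R * X := (ival_shift d b.1, b.2).

Definition barcode_shift (R : realType) (X : Type) (d : R)
  (C : barcode R X) : barcode R X := bar_shift d @` C.

Definition relation_shift (R : realType) (X Y : Type) (d : R)
    (f : bar_relation R X Y) : bar_relation R X Y :=
  [set (bar_shift d p.1, bar_shift d p.2) | p in f].

Definition in_halfopen (R : realType) (d : R) (I : ival R) : Prop :=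
  exists a : R, (I `<=` `[a, a + d[) \/ (I `<=` `]a, a + d]).

(* S^{C,d} *)
Definition barcode_transition (R : realType) (X : Type) (C : barcode R X)
    (d : R) : bar_relation R X X :=
  [set (b, bar_shift d b) | b in [set b | C b /\ ~ in_halfopen d b.1]].

(* All barcodes with indices in X have bars in the same type, so C(d)(d) and
   C(d + d) need no identification here. *)
Definition is_binterleaving (R : realType) (X Y : Type) (C : barcode R X)
    (D : barcode R Y) (d : R)
    (f : bar_relation R X Y) (g : bar_relation R Y X) : Prop :=
  [/\ overlap_matching C (barcode_shift d D) f,
      overlap_matching D (barcode_shift d C) g,
      overlap_comp (relation_shift d g) f = barcode_transition C (d + d) &
      overlap_comp (relation_shift d f) g = barcode_transition D (d + d)].

Definition binterleaved (R : realType) (X Y : Type) (C : barcode R X)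
    (D : barcode R Y) (d : R) : Prop :=
  exists (f : bar_relation R X Y) (g : bar_relation R Y X),
    is_binterleaving C D d f g.

Definition bdist (R : realType) (X Y : Type) (C : barcode R X)
    (D : barcode R Y) : \bar R :=
  ereal_inf [set d%:E | d in [set d : R | 0 <= d /\ binterleaved C D d]].

(* Main.v *)
(* Structure theorem (Crawley-Boevey).  At an index t of an interval I, the
   vectors of M_t coming from all of I and killed beyond I contain those that
   come from before I or die within I; the quotient does not depend on t in I.
   As M_t is finite dimensional, a basis of the quotient lifts to compatible
   families over I, and all these families together form a basis of M_t.

   From barcodes to modules, a matched pair of bars contributes an identity
   matrix entry, and overlapping is exactly naturality.

   From modules to barcodes (Bjerkevik), an interleaving gives two matrices of
   scalars F and G indexed by bars.  Call a bar long if it meets its shift by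
   2 delta.  For finitely many long bars I, ordered by the sum of their end
   points, the matrix GF is unitriangular, and only the bars J whose ends are
   within delta of those of some I matter in its lower part.  Hence there are
   at least as many such J as I, and Hall's theorem for infinite families gives
   an injection; a Cantor-Bernstein argument merges the injections obtained from
   both sides into a matching, which restricts to the required interleaving. *)

From HB Require Import structures.
From mathcomp Require Import all_boot all_order all_algebra.
From mathcomp Require Import all_classical all_reals.
From mathcomp Require Import finmap lra.
Require Import Defs.

Set Implicit Arguments.
Unset Strict Implicit.
Unset Printing Implicit Defensive.

Import Order.TTheory GRing.Theory Num.Theory.
Local Open Scope classical_set_scope.
Local Open Scope ring_scope.

Local Notation iv := ival_set.

(** * Intervals and auxiliary algebra *)

Section IntervalEnds.
Variable R : realType.
Implicit Types I J L : ival R.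

(** Ends are compared as cuts of the line: open, closed and infinite ends are covered at once, and
    the two comparisons are total preorders. *)
Definition lo_le I J := forall x, iv J x -> exists2 y, iv I y & y <= x.
Definition hi_le I J := forall x, iv I x -> exists2 y, iv J y & x <= y.

Lemma lo_leP I J : lo_le I J \/ exists2 x, iv J x & forall y, iv I y -> x < y.
Proof.
have [h|/existsNP[x /not_implyP[Jx h]]] := pselect (lo_le I J); [by left|right].
exists x => // y Iy; rewrite ltNge; apply/negP => yx.
by apply: h; exists y.
Qed.

Lemma hi_leP I J : hi_le I J \/ exists2 x, iv I x & forall y, iv J y -> y < x.
Proof.
have [h|/existsNP[x /not_implyP[Jx h]]] := pselect (hi_le I J); [by left|right].
exists x => // y Iy; rewrite ltNge; apply/negP => yx.
by apply: h; exists y.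
Qed.

Lemma lo_le_refl I : lo_le I I.
Proof. by move=> x Ix; exists x. Qed.

Lemma lo_le_trans I J L : lo_le I J -> lo_le J L -> lo_le I L.
Proof.
by move=> IJ JL x /JL[y /IJ[z Iz zy] yx]; exists z => //; exact: le_trans yx.
Qed.

Lemma hi_le_trans I J L : hi_le I J -> hi_le J L -> hi_le I L.
Proof.
by move=> IJ JL x /IJ[y /JL[z Iz zy] yx]; exists z => //; exact: le_trans zy.
Qed.

Lemma lo_le_total I J : lo_le I J \/ lo_le J I.
Proof.
have [|[x Jx xI]] := lo_leP I J; [by left|right=> y Iy].
by exists x => //; exact/ltW/xI.
Qed.

Lemma hi_le_total I J : hi_le I J \/ hi_le J I.
Proof.
have [|[x Jx xI]] := hi_leP I J; [by left|right=> y Iy].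
by exists x => //; exact/ltW/xI.
Qed.

Lemma ival_between I x y z : iv I x -> iv I z -> x <= y -> y <= z -> iv I y.
Proof. by move=> Ix Iz xy yz; apply: (ival_interval Ix Iz); rewrite xy. Qed.

Lemma ival_eq I J : (forall x, iv I x <-> iv J x) -> I = J.
Proof.
case: I J => [I I0 Ii] [J J0 Ji] /= IJ.
have {}IJ : I = J by apply/seteqP; split => x /IJ.
by subst J; congr Ival; exact: Prop_irrelevance.
Qed.

Lemma lo_hi_mem I J x : lo_le I J -> hi_le J I -> iv J x -> iv I x.
Proof.
move=> IJ JI Jx; have [y Iy yx] := IJ _ Jx; have [z Iz xz] := JI _ Jx.
exact: ival_between Iy Iz yx xz.
Qed.

Lemma lo_hi_eq I J : lo_le I J -> lo_le J I -> hi_le I J -> hi_le J I -> I = J.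
Proof. by move=> *; apply: ival_eq => x; split; exact: lo_hi_mem. Qed.

(** Take a constant sequence if [I] has a minimum, points below [-n] if [I] is unbounded below, and
    otherwise points within [1/(n+1)] of the infimum. Running minima starting from [t0] make the
    sequence decreasing. *)
Lemma ival_coinitial I (t0 : R) : iv I t0 -> exists s : nat -> R,
  [/\ s 0%N = t0, forall n, iv I (s n), forall n, s n.+1 <= s n &
      forall t, iv I t -> exists n, s n <= t].
Proof.
move=> It0; suff [c Ic cI] : exists2 c : nat -> R, forall n, iv I (c n) &
    forall t, iv I t -> exists n, c n <= t.
  pose s := fix s n := if n is m.+1 then Num.min (s m) (c m) else t0.
  exists s; split=> //= [||t /cI[n cnt]].
  - by elim=> //= n IH; rewrite minEle; case: ifP.
  - by move=> n; rewrite ge_min lexx.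
  - by exists n.+1; rewrite /= ge_min cnt orbT.
have [[m Im mI]|nomin] := pselect (exists2 m, iv I m & forall t, iv I t -> m <= t).
  by exists (fun=> m) => // t /mI mt; exists 0%N.
have {}nomin m : iv I m -> exists2 t, iv I t & t < m.
  move=> Im; apply: contrapT => h; apply: nomin; exists m => // t It.
  by rewrite leNgt; apply/negP => tm; apply: h; exists t.
have [lbI|nlbI] := pselect (has_lbound (ival_set I)); last first.
  have /choice[c hc] : forall n : nat, exists x, iv I x /\ x <= - n%:R.
    move=> n; apply: contrapT => /forallNP h; apply: nlbI; exists (- n%:R) => x Ix.
    by case/not_andP: (h x) => // /negP; rewrite -ltNge => /ltW.
  exists c => [n|t It]; first by case: (hc n).
  exists (Num.bound `|t|); apply: le_trans (proj2 (hc _)) _.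
  by rewrite lerNl; rewrite -normrN (le_trans (ler_norm _)) // ltW ?archi_boundP.
have hinf : has_inf (ival_set I) by split => //; exists t0.
have /choice[c hc] : forall n : nat, exists x, iv I x /\ x < inf (ival_set I) + n.+1%:R^-1.
  move=> n; have n0 : 0 < n.+1%:R^-1 :> R by rewrite invr_gt0.
  by have [x Ix xlt] := inf_adherent n0 hinf; exists x.
exists c => [n|t It]; first by case: (hc n).
have [u Iu ut] := nomin t It.
have uinf : inf (ival_set I) <= u by apply: ge_inf.
have [n hn] := ltr_add_invr ut.
exists n; apply/ltW/(lt_trans (proj2 (hc n)))/(le_lt_trans _ hn).
by rewrite lerD2r.
Qed.

End IntervalEnds.

HB.instance Definition _ (R : realType) := gen_eqMixin (ival R).
HB.instance Definition _ (R : realType) := gen_choiceMixin (ival R).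

(** Used to pick an extremal member of a finite support for a total preorder, such as the comparison
    of lower ends alone, of upper ends alone, or of sums of ends. *)
Lemma total_max_in (T : eqType) (le : T -> T -> Prop) (P : T -> Prop) (s : seq T) :
  (forall x y, le x y \/ le y x) ->
  (forall x y z, le x y -> le y z -> le x z) ->
  (exists2 x, x \in s & P x) ->
  exists x, [/\ x \in s, P x & forall y, y \in s -> P y -> le y x].
Proof.
move=> tot tr; elim: s => [[x]//|a s IH] [x xas Px].
have [[z zs Pz]|h] := pselect (exists2 x, x \in s & P x); last first.
  have [ax|nax] := eqVneq x a.
    exists x; split => // y; rewrite inE -ax => /predU1P[-> _|ys Py].
      by case: (tot x x).
    by case: h; exists y.
  by case: h; exists x => //; move: xas; rewrite inE (negPf nax).
have [m [ms Pm mmax]] := IH (ex_intro2 _ _ z zs Pz).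
have [Pa|nPa] := pselect (P a); last first.
  exists m; split; rewrite ?inE ?ms ?orbT// => y; rewrite inE => /predU1P[->//|].
  exact: mmax.
have lerefl y : le y y by case: (tot y y).
have [am|ma] := tot a m.
  exists m; split; rewrite ?inE ?ms ?orbT// => y; rewrite inE => /predU1P[->//|].
  exact: mmax.
exists a; split; rewrite ?mem_head// => y; rewrite inE => /predU1P[->//|ys Py].
exact: tr (mmax _ ys Py) ma.
Qed.

Lemma finite_set_uniq_bound (T : choiceType) (A : set T) (n : nat) :
  (forall s : seq T, uniq s -> (forall x, x \in s -> A x) -> (size s <= n)%N) ->
  finite_set A.
Proof.
move=> h; apply: contrapT => infA; have [B BA nB] := infinite_set_fset n.+1 infA.
have := h (enum_fset B) (fset_uniq B) (fun x xB => BA x xB).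
by rewrite leqNgt nB.
Qed.

Lemma eq_sum_support (T : eqType) (V : zmodType) (s1 s2 : seq T) (F : T -> V) :
  uniq s1 -> uniq s2 -> (forall x, F x != 0 -> (x \in s1) = (x \in s2)) ->
  \sum_(x <- s1) F x = \sum_(x <- s2) F x.
Proof.
move=> u1 u2 s12.
have supp s : \sum_(x <- s) F x = \sum_(x <- [seq x <- s | F x != 0]) F x.
  rewrite big_filter [LHS](bigID (fun x => F x != 0)) /= [X in _ + X]big1 ?addr0//.
  by move=> x /negPn/eqP.
rewrite supp [RHS]supp; apply: perm_big; apply: uniq_perm; rewrite ?filter_uniq//.
by move=> x; rewrite !mem_filter; case: (boolP (F x == 0)) => //= /s12.
Qed.

(** Membership has to be checked only for terms with non-zero coefficient, so extremality among the
    bars of a support can be used. *)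
Lemma linear_pred_sum (K : fieldType) (V : lmodType K) (T : eqType) (P : V -> Prop)
    (s : seq T) (Q : pred T) (c : T -> K) (F : T -> V) :
  P 0 -> (forall a u v, P u -> P v -> P (a *: u + v)) ->
  (forall x, x \in s -> Q x -> c x != 0 -> P (F x)) ->
  P (\sum_(x <- s | Q x) c x *: F x).
Proof.
move=> P0 PD sP; rewrite big_seq_cond; elim/big_ind: _ => // [u v Pu Pv|x].
  by rewrite -[u]scale1r; exact: PD.
move=> /andP[xs Qx]; rewrite -[_ *: _]addr0.
by have [->|cx] := eqVneq (c x) 0; [rewrite scale0r addr0|apply: PD => //; exact: sP].
Qed.

Section Subspaces.
Variables (K : fieldType) (V : vectType K).

(* A subspace contained in P of maximal dimension contains everything. *)
Lemma subspace_of_pred (P : V -> Prop) :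
  P 0 -> (forall a u v, P u -> P v -> P (a *: u + v)) ->
  exists U : {vspace V}, forall v, v \in U <-> P v.
Proof.
move=> P0 PD; pose Q n := `[< exists2 U : {vspace V},
  (forall v, v \in U -> P v) & \dim U = n >].
have exQ : exists n, Q n.
  by exists 0%N; apply/asboolP; exists 0%VS; rewrite ?dimv0// => v /vlineP[k ->];
     rewrite scaler0.
have Qb n : Q n -> (n <= \dim {:V})%N.
  by move=> /asboolP[U _ <-]; rewrite dimvS// subvf.
have [n /asboolP[U UP Un] nmax] := ex_maxnP exQ Qb.
exists U => v; split=> [|Pv]; first exact: UP.
apply: contrapT => /negP vU.
have /nmax : Q (\dim (U + <[v]>)%VS).
  apply/asboolP; exists (U + <[v]>)%VS => // w /memv_addP[u /UP Pu [z]].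
  by move=> /vlineP[k ->] ->; rewrite addrC; exact: PD.
rewrite -Un leqNgt ltnNge; case/negP; rewrite -ltnNge.
rewrite ltn_neqAle dimvS ?addvSl// andbT.
apply: contra vU => /eqP dU.
have /eqP -> : U == (U + <[v]>)%VS by rewrite eqEdim addvSl dU leqnn.
exact: subvP (addvSr U <[v]>) _ (memv_line v).
Qed.

End Subspaces.

(** * Coordinates on a barcode module *)

Lemma kmap_true_inj (K : fieldType) (b : bool) : injective (kmap K b true).
Proof. by case: b => // u v _; rewrite [u]thinmx0 [v]thinmx0. Qed.

Lemma kmap_false (K : fieldType) (b c : bool) (u : kobj K b) : ~~ b -> kmap K b c u = 0.
Proof. by case: b u. Qed.

Lemma kmap_comp_true (K : fieldType) (b c : bool) (u : kobj K b) :
  kmap K c true (kmap K b c u) = if c then kmap K b true u else 0.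
Proof. by case: b u; case: c => //= u; rewrite linear0. Qed.

Section Coordinates.
Variables (R : realType) (K : fieldType) (X : choiceType) (C : barcode R X).
Local Notation P := (barcode_module K C).
Implicit Types (s t : R) (b : set_type C).

(* Junk value 0 if [t] is outside of the bar [b]. *)
Definition bar_coord t (x : P t) b : K :=
  kmap K `[< iv (val b).1 t >] true (dsum_fun x b).

Lemma bar_coord_inj t (x y : P t) : (forall b, bar_coord x b = bar_coord y b) -> x = y.
Proof.
by move=> xy; apply: dsum_eq => b; apply: kmap_true_inj; exact: xy.
Qed.

Lemma bar_coord_out t (x : P t) b : ~ iv (val b).1 t -> bar_coord x b = 0.
Proof. by move=> bt; rewrite /bar_coord kmap_false//; exact/asboolPn. Qed.

Lemma bar_coordP t a (x y : P t) b : bar_coord (a *: x + y) b = a * bar_coord x b + bar_coord y b.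
Proof. by rewrite /bar_coord linearP. Qed.

Lemma bar_coord0 t b : bar_coord (0 : P t) b = 0.
Proof. by rewrite /bar_coord linear0. Qed.

Lemma bar_coordD t (x y : P t) b : bar_coord (x + y) b = bar_coord x b + bar_coord y b.
Proof. by rewrite -[x]scale1r bar_coordP mul1r scale1r. Qed.

Lemma bar_coordZ t a (x : P t) b : bar_coord (a *: x) b = a * bar_coord x b.
Proof. by rewrite -[_ *: _]addr0 bar_coordP bar_coord0 addr0. Qed.

Lemma bar_coord_sum t (I : Type) (s : seq I) (F : I -> P t) b :
  bar_coord (\sum_(i <- s) F i) b = \sum_(i <- s) bar_coord (F i) b.
Proof.
by elim: s => [|i s IH]; rewrite ?big_nil ?bar_coord0// !big_cons bar_coordD IH.
Qed.

Lemma bar_coord_map s t (h : s <= t) (x : P s) b :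
  bar_coord (pmap P h x) b = if `[< iv (val b).1 t >] then bar_coord x b else 0.
Proof.
exact: kmap_comp_true.
Qed.

Lemma bar_coord_map_in s t (h : s <= t) (x : P s) b :
  iv (val b).1 t -> bar_coord (pmap P h x) b = bar_coord x b.
Proof. by move=> bt; rewrite bar_coord_map asboolT. Qed.

Lemma bar_coord_finite t (x : P t) : finite_set [set b | bar_coord x b <> 0].
Proof.
apply: sub_finite_set (dsum_finite x) => b /= cb xb; apply: cb.
by rewrite /bar_coord xb linear0.
Qed.

Lemma dsum_of_finite t (u : set_type C -> K) : finite_set [set b | u b <> 0] ->
  finite_set [set b | kmap K true `[< iv (val b).1 t >] (u b) <> 0].
Proof.
apply: sub_finite_set => b /= h ub; apply: h.
by rewrite ub; exact: linear0.
Qed.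

Definition dsum_of t (u : set_type C -> K) (fu : finite_set [set b | u b <> 0]) : P t :=
  DSum (dsum_of_finite t fu).

Lemma bar_coord_dsum_of t u (fu : finite_set [set b | u b <> 0]) b :
  bar_coord (dsum_of t fu) b = if `[< iv (val b).1 t >] then u b else 0.
Proof. exact: (@kmap_comp_true _ true). Qed.

Lemma delta_finite b : finite_set [set b' | (b' == b)%:R <> 0 :> K].
Proof.
apply: (sub_finite_set _ (finite_set1 b)) => b' /=.
by case: eqP.
Qed.

(** This is the zero vector if [t] is outside of the bar [b], as [dsum_of] drops the coordinates
    there. *)
Definition bar_elt t b : P t := dsum_of t (delta_finite b).

Lemma bar_coord_bar_elt t b b' : iv (val b).1 t -> bar_coord (bar_elt t b) b' = (b' == b)%:R.
Proof.
move=> bt; rewrite bar_coord_dsum_of; case: eqP => [->|]; first by rewrite asboolT.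
by case: ifP.
Qed.

Lemma bar_elt_map s t (h : s <= t) b : iv (val b).1 s -> iv (val b).1 t ->
  pmap P h (bar_elt s b) = bar_elt t b.
Proof.
move=> bs bt; apply: bar_coord_inj => b'.
rewrite bar_coord_map !bar_coord_bar_elt//; case: ifP => // /negbT/asboolPn.
by case: eqP => // ->.
Qed.

Lemma bar_elt_map0 s t (h : s <= t) b : ~ iv (val b).1 t ->
  pmap P h (bar_elt s b) = 0.
Proof.
move=> bt; apply: bar_coord_inj => b'; rewrite bar_coord_map bar_coord0 bar_coord_dsum_of.
by case: ifP => // /asboolP b't; case: ifP => // _; case: eqP => // bb; rewrite bb in b't.
Qed.

Lemma bar_coord_sum_bars t (L : seq (set_type C)) (x : P t) : uniq L ->
  (forall b, bar_coord x b != 0 -> b \in L) ->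
  x = \sum_(b <- L) bar_coord x b *: bar_elt t b.
Proof.
move=> uL hL; apply: bar_coord_inj => b; rewrite bar_coord_sum.
(* A non-zero coordinate forces [t] into the bar [b'], so [bar_elt t b'] is a true basis vector. *)
have xL b' : bar_coord x b' != 0 -> bar_coord (bar_elt t b') b = (b == b')%:R.
  move=> xb'; apply: bar_coord_bar_elt; apply: contrapT => /(bar_coord_out x)/eqP.
  exact/negP.
transitivity (\sum_(b' <- L) (if b' == b then bar_coord x b else 0)).
  rewrite -big_mkcond /= -big_filter; have [bL|bL] := boolP (b \in L).
    by rewrite (filter_pred1_uniq uL)// big_seq1.
  have -> : [seq b' <- L | b' == b] = [::].
    apply/eqP; rewrite -(negbK (_ == _)) -has_filter; apply: contra bL.
    by move=> /hasP[b' ? /eqP <-].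
  by rewrite big_nil; apply: contraNeq bL; exact: hL.
apply: eq_bigr => b' _; rewrite bar_coordZ.
have [xb'|/xL ->] := eqVneq (bar_coord x b') 0.
  by case: eqP => [<-|_]; rewrite xb' mul0r.
by rewrite eq_sym; case: eqP => [->|_]; rewrite ?mulr1 ?mulr0.
Qed.

End Coordinates.

(** * The structure theorem *)

Section Structure.
Variables (R : realType) (K : fieldType) (M : pfd_module R K).
Implicit Types (I J : ival R) (s t r : R).
Local Notation V := (pfd_obj M).

(* Internal maps without the proof argument, with value 0 when [t < s]. *)
Definition tr s t : 'Hom(V s, V t) :=
  match boolP (s <= t) with
  | AltTrue h => linfun (pfd_map M h)
  | AltFalse _ => 0
  end.

Lemma trE s t (h : s <= t) v : tr s t v = pfd_map M h v.
Proof.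
rewrite /tr; case: {-}_ / boolP => [h'|]; last by rewrite h.
by rewrite lfunE /= (bool_irrelevance h' h).
Qed.

Lemma tr_id t v : tr t t v = v.
Proof. by rewrite (trE (lexx t)) pfd_map_id. Qed.

Lemma tr_comp s t u v : s <= t -> t <= u -> tr t u (tr s t v) = tr s u v.
Proof.
move=> st tu; rewrite (trE st) (trE tu) (trE (le_trans st tu)).
by rewrite (pfd_map_comp st tu).
Qed.

Lemma tr_img s t r v : s <= r -> r <= t -> v \in limg (tr s t) -> v \in limg (tr r t).
Proof.
move=> sr rt /memv_imgP[w _ ->]; rewrite -(tr_comp _ sr rt).
exact/memv_img/memvf.
Qed.

Lemma tr_imgP s t v : reflect (exists w, v = tr s t w) (v \in limg (tr s t)).
Proof.
apply: (iffP memv_imgP) => [[w _ ->]|[w ->]]; first by exists w.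
by exists w => //; exact: memvf.
Qed.

(* Im^+, Im^-, Ker^+, Ker^-, V^+ and V^- of the functorial filtration: the
   letters P and M stand for the exponents + and -. *)
Definition imP I t (v : V t) := forall s, iv I s -> s <= t -> v \in limg (tr s t).
Definition imM I t (v : V t) := v = 0 \/
  exists s, [/\ s <= t, forall x, iv I x -> s < x & v \in limg (tr s t)].
Definition kerP I t (v : V t) := forall r, (forall x, iv I x -> x < r) -> tr t r v = 0.
Definition kerM I t (v : V t) := exists r, [/\ iv I r, t <= r & tr t r v = 0].
Definition vP I t v := @imP I t v /\ @kerP I t v.
Definition vM I t v := exists a b : V t,
  [/\ v = a + b, @imM I t a, @kerP I t a, @imP I t b & @kerM I t b].

Lemma imM_imP I t v : @imM I t v -> imP I v.
Proof.
move=> [->|[s [st sI vs]]] r Ir rt; first exact: mem0v.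
exact: tr_img (ltW (sI _ Ir)) rt vs.
Qed.

Lemma imP_lin I t a u v : @imP I t u -> imP I v -> imP I (a *: u + v).
Proof. by move=> hu hv s Is st; rewrite memvD ?memvZ ?hu ?hv. Qed.

Lemma imM_lin I t a u v : @imM I t u -> imM I v -> imM I (a *: u + v).
Proof.
move=> [->|[s [st sI us]]]; first by rewrite scaler0 add0r.
move=> [->|[r [rt rI vr]]]; first by right; exists s; split; rewrite ?memvD ?memvZ ?mem0v.
right; have [sr|/ltW rs] := leP s r.
  by exists r; split => //; rewrite memvD ?memvZ // (tr_img sr).
by exists s; split => //; rewrite memvD ?memvZ // (tr_img rs).
Qed.

Lemma kerP_lin I t a u v : @kerP I t u -> kerP I v -> kerP I (a *: u + v).
Proof. by move=> hu hv r Ir; rewrite linearP /= hu ?hv// scaler0 addr0. Qed.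

Lemma kerM_lin I t a u v : @kerM I t u -> kerM I v -> kerM I (a *: u + v).
Proof.
move=> [s [Is ts us]] [r [Ir tr_ vr]].
have [sr|/ltW rs] := leP s r.
  by exists r; split => //; rewrite linearP /= vr -(tr_comp _ ts sr) us !linear0 addr0.
by exists s; split => //; rewrite linearP /= us -(tr_comp _ tr_ rs) vr !linear0 addr0.
Qed.

Lemma imP0 I t : imP I (0 : V t).
Proof. by move=> s _ _; exact: mem0v. Qed.

Lemma imM0 I t : imM I (0 : V t). Proof. by left. Qed.

Lemma kerP0 I t : kerP I (0 : V t).
Proof. by move=> r _; exact: linear0. Qed.

Lemma kerM0 I t : iv I t -> kerM I (0 : V t).
Proof. by move=> It; exists t; rewrite linear0. Qed.

Lemma vP0 I t : vP I (0 : V t).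
Proof. by split; [exact: imP0|exact: kerP0]. Qed.

Lemma vM0 I t : iv I t -> vM I (0 : V t).
Proof.
by move=> It; exists 0, 0; split; rewrite ?addr0//;
  [exact: imM0|exact: kerP0|exact: imP0|exact: kerM0].
Qed.

Lemma vP_lin I t a u v : @vP I t u -> vP I v -> vP I (a *: u + v).
Proof. by move=> [? ?] [? ?]; split; [exact: imP_lin|exact: kerP_lin]. Qed.

Lemma vM_lin I t a u v : @vM I t u -> vM I v -> vM I (a *: u + v).
Proof.
move=> [u1 [u2 [-> ? ? ? ?]]] [v1 [v2 [-> ? ? ? ?]]].
exists (a *: u1 + v1), (a *: u2 + v2); split.
- by rewrite scalerDr addrACA.
- exact: imM_lin.
- exact: kerP_lin.
- exact: imP_lin.
- exact: kerM_lin.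
Qed.

(** The images in [V s] of the earlier spaces over [I] form a chain, and one of them has least
    dimension. A preimage of [v] chosen in that one lies in all of them. *)
Lemma imP_lift I s t v : iv I s -> s <= t -> @imP I t v ->
  exists2 w, @imP I s w & tr s t w = v.
Proof.
move=> Is st vI; pose Q n := `[< exists r, [/\ iv I r, r <= s & \dim (limg (tr r s)) = n] >].
have exQ : exists n, Q n by exists (\dim (limg (tr s s))); apply/asboolP; exists s.
have [n /asboolP[r [Ir rs rn]] nmin] := ex_minnP exQ.
have /tr_imgP[z vz] := vI r Ir (le_trans rs st).
exists (tr r s z); last by rewrite tr_comp.
move=> q Iq qs; have [rq|/ltW qr] := leP r q.
  by apply: tr_img rq qs _; apply/tr_imgP; exists z.
have sub : (limg (tr q s) <= limg (tr r s))%VS.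
  by apply/subvP => w; exact: tr_img.
have /eqP -> : limg (tr q s) == limg (tr r s).
  by rewrite eqEdim sub rn nmin//; apply/asboolP; exists q.
by apply/tr_imgP; exists z.
Qed.

Lemma kerP_reflect I s t v : iv I t -> s <= t -> @kerP I t (tr s t v) -> kerP I v.
Proof.
move=> It st h r Ir; have tr_ := ltW (Ir _ It).
by rewrite -(tr_comp _ st tr_) h.
Qed.

Lemma kerP_map I s t v : iv I t -> s <= t -> @kerP I s v -> kerP I (tr s t v).
Proof.
by move=> It st h r Ir; rewrite tr_comp ?h// ltW// Ir.
Qed.

Lemma imP_map I s t v : s <= t -> @imP I s v -> imP I (tr s t v).
Proof.
move=> st h q Iq qt; have [qs|/ltW sq] := leP q s.
  have /tr_imgP[z ->] := h q Iq qs.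
  by rewrite tr_comp//; apply/tr_imgP; exists z.
by apply/tr_imgP; exists (tr s q v); rewrite tr_comp.
Qed.

Lemma vP_lift I s t v : iv I s -> iv I t -> s <= t -> @vP I t v ->
  exists2 w, @vP I s w & tr s t w = v.
Proof.
move=> Is It st [/(imP_lift Is st)[w iw wv] kv].
by exists w => //; split=> //; apply: (kerP_reflect It st); rewrite wv.
Qed.

Lemma vP_map I s t v : iv I t -> s <= t -> @vP I s v -> vP I (tr s t v).
Proof. by move=> It st [iv_ kv]; split; [exact: imP_map|exact: kerP_map]. Qed.

Lemma vM_map I s t v : iv I s -> iv I t -> s <= t -> @vM I s v -> vM I (tr s t v).
Proof.
move=> Is It st [a [b [-> ia ka ib kb]]].
exists (tr s t a), (tr s t b); split; first exact: linearD.
- case: ia => [->|[q [qs qI /tr_imgP[z ->]]]]; first by left; exact: linear0.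
  right; exists q; split => //; first exact: le_trans st.
  by rewrite tr_comp//; apply/tr_imgP; exists z.
- exact: kerP_map.
- exact: imP_map.
- case: kb => r [Ir sr br]; have [tr_|/ltW rt] := leP t r.
    by exists r; rewrite tr_comp.
  by exists t; split; rewrite // -(tr_comp _ sr rt) br !linear0.
Qed.

(** Lifting both summands of the image would recover [v] only up to the kernel of [tr s t]. So only
    the early-born summand is lifted, to [a'], and [v - a'] serves as the other: its image is [b],
    hence it dies where [b] does. *)
Lemma vM_reflect I s t v : iv I s -> iv I t -> s <= t ->
  @vP I s v -> vM I (tr s t v) -> vM I v.
Proof.
move=> Is It st [iv_ kv] [a [b [vab ia ka ib kb]]].
have [a' [ia' aa']] : exists a', imM I a' /\ tr s t a' = a.
  case: ia => [->|[q [qt qI /tr_imgP[z ->]]]].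
    by exists 0; split; [left|rewrite linear0].
  have qs : q <= s by exact/ltW/qI.
  exists (tr q s z); split; last by rewrite tr_comp.
  by right; exists q; split => //; apply/tr_imgP; exists z.
have [b' ib' bb'] := imP_lift Is st ib.
have ka' : kerP I a' by apply: (kerP_reflect It st); rewrite aa'.
exists a', (v - a'); split => //; first by rewrite addrC subrK.
  by rewrite addrC -scaleN1r; apply: imP_lin => //; exact: imM_imP.
case: kb => r [Ir tr_ br]; exists r; split=> //; first exact: le_trans tr_.
rewrite linearB /= -!(tr_comp _ st tr_) aa' vab.
by rewrite -linearB /= addrC addKr br.
Qed.

(* The maps between the V^+ are onto, so [v0] lifts step by step along a
   sequence coinitial in [I]. *)
Lemma compatible_family I t0 v0 : iv I t0 -> @vP I t0 v0 ->
  exists y : forall t, V t, [/\ y t0 = v0, forall t, iv I t -> vP I (y t) &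
    forall s t, iv I s -> iv I t -> s <= t -> tr s t (y s) = y t].
Proof.
move=> It0 v0P; have [c [c0 cI cdecr ccoin]] := ival_coinitial It0.
have step n (z : {v : V (c n) | vP I v}) :
    {w : {v : V (c n.+1) | vP I v} | tr (c n.+1) (c n) (sval w) = sval z}.
  have := vP_lift (cI n.+1) (cI n) (cdecr n) (svalP z).
  by move=> /cid2[w wP wz]; exists (exist _ w wP).
have z0P : vP I (tr t0 (c 0%N) v0) by rewrite c0 tr_id.
pose z0 : {v : V (c 0%N) | vP I v} := exist _ _ z0P.
pose z := nat_rect (fun n => {v : V (c n) | vP I v}) z0 (fun n x => sval (step n x)).
have zS n : tr (c n.+1) (c n) (sval (z n.+1)) = sval (z n) by exact: svalP (step n (z n)).
have c_le n k : c (n + k)%N <= c n.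
  by elim: k => [|k IH]; rewrite ?addn0// addnS (le_trans (cdecr _)).
have zD n k : tr (c (n + k)%N) (c n) (sval (z (n + k)%N)) = sval (z n).
  elim: k => [|k IH]; first by rewrite addn0 tr_id.
  by rewrite addnS -[RHS]IH -[in RHS]zS tr_comp.
have zt n m t : c n <= t -> c m <= t -> tr (c n) t (sval (z n)) = tr (c m) t (sval (z m)).
  wlog nm : n m / (n <= m)%N => [hw cn cm|cn cm].
    by have [?|/ltnW ?] := leqP n m; [|symmetry]; exact: hw.
  by rewrite -(zD n (m - n)%N) subnKC// tr_comp// -(subnKC nm).
(* By [zt] every admissible [n] gives the same vector. The default 0 occurs only below the whole
   sequence, hence outside of [I]. *)
have ht t : exists v, forall n, c n <= t -> v = tr (c n) t (sval (z n)).
  have [[n cn]|h] := pselect (exists n, c n <= t).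
    by exists (tr (c n) t (sval (z n))) => m cm; exact: zt.
  by exists 0 => n cn; case: h; exists n.
pose y t := sval (cid (ht t)).
have yE t n : c n <= t -> y t = tr (c n) t (sval (z n)) by exact: (svalP (cid (ht t))).
exists y; split=> [|t It|s t Is It st].
- by rewrite (yE t0 0%N) ?c0//= tr_comp ?c0// tr_id.
- have [n cn] := ccoin t It; rewrite (yE _ n)//.
  by apply: vP_map => //; exact: svalP.
- have [n cn] := ccoin s Is; rewrite (yE s n)// tr_comp//.
  by rewrite (yE t n)// (le_trans cn).
Qed.

(** At one index [t0], a basis of a complement of [V^-] in [V^+] is lifted to compatible families.
    Independence and generation modulo [V^-] pass between [t0] and any other index of [I] by
    [vM_map] and [vM_reflect]. *)
Lemma interval_basis I : exists (m : nat) (y : nat -> forall t, V t),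
  [/\ forall k t, iv I t -> vP I (y k t),
      forall k s t, iv I s -> iv I t -> s <= t -> tr s t (y k s) = y k t,
      forall t (c : nat -> K), iv I t -> vM I (\sum_(k < m) c k *: y k t) ->
        forall k, (k < m)%N -> c k = 0 &
      forall t v, iv I t -> @vP I t v ->
        exists c : nat -> K, vM I (v - \sum_(k < m) c k *: y k t)].
Proof.
have [t0 It0] := ival_nonempty I.
have [U UP] := subspace_of_pred (vP0 I t0) (@vP_lin I t0).
have [W WP] := subspace_of_pred (vM0 It0) (@vM_lin I t0).
pose X := vbasis (U :\: W); set m := \dim (U :\: W) in X.
have XU k : vP I X`_k.
  apply/UP; have [km|mk] := ltnP k m; last by rewrite nth_default ?size_tuple// mem0v.
  by apply: (subvP (diffvSl U W)); apply: vbasis_mem; rewrite mem_nth// size_tuple.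
have /choice[y hy] k := compatible_family It0 (XU k).
have y0 k : y k t0 = X`_k by case: (hy k).
have yP k t : iv I t -> vP I (y k t) by case: (hy k) => _ + _; apply.
have ytr k s t : iv I s -> iv I t -> s <= t -> tr s t (y k s) = y k t.
  by case: (hy k) => _ _; apply.
have trsum s t c : iv I s -> iv I t -> s <= t ->
    tr s t (\sum_(k < m) c k *: y k s) = \sum_(k < m) c k *: y k t.
  by move=> Is It st; rewrite linear_sum; apply: eq_bigr => k _; rewrite linearZ /= ytr.
have sumP t c : iv I t -> vP I (\sum_(k < m) c k *: y k t).
  move=> It; elim/big_ind: _ => [|u v uP vP_|k _]; first exact: vP0.
    by rewrite -[u]scale1r; exact: vP_lin.
  by rewrite -[_ *: _]addr0; apply: vP_lin; [exact: yP|exact: vP0].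
exists m, y; split => // [t c It sM k km|t v It vI].
  have {t It sM} sM : vM I (\sum_(k < m) c k *: y k t0).
    have [t0t|/ltW tt0] := leP t0 t.
      by apply: (vM_reflect It0 It t0t); [exact: sumP|rewrite trsum].
    by rewrite -(trsum t)//; exact: vM_map.
  have s0 : \sum_(k < m) c k *: X`_k = 0.
    apply/eqP; rewrite -memv0 -(capv_diff U W) memv_cap; apply/andP; split.
      by apply: memv_suml => i _; apply: memvZ; apply: vbasis_mem; rewrite mem_nth// size_tuple.
    by apply/WP; under eq_bigr do rewrite -y0.
  have /freeP/(_ _ s0) := basis_free (vbasisP (U :\: W)%VS).
  by move=> /(_ (Ordinal km)).
have t0span w : vP I w -> exists c : nat -> K, vM I (w - \sum_(k < m) c k *: y k t0).
  move=> /UP; rewrite -(addv_diff_cap U W) => /memv_addP[a aD [b /memv_capP[_ bW] ->]].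
  (* Coordinates are indexed by ordinals, so they are extended by 0 to all natural numbers. *)
  exists (fun k => oapp (fun i => coord X i a) 0 (insub k)).
  apply/WP; rewrite {1}(coord_vbasis aD) addrAC.
  rewrite [X in X + b](_ : _ = 0) ?add0r//; apply/eqP; rewrite subr_eq0; apply/eqP.
  by apply: eq_bigr => i _; rewrite valK /= y0.
have [t0t|/ltW tt0] := leP t0 t.
  have [w wP wv] := vP_lift It0 It t0t vI; have [c hc] := t0span w wP.
  by exists c; rewrite -wv -(trsum t0)// -linearB; exact: vM_map.
have [c hc] := t0span _ (vP_map It0 tt0 vI).
exists c; apply: (vM_reflect It It0 tt0); last by rewrite linearB /= trsum.
by rewrite addrC -scaleN1r; apply: vP_lin => //; exact: sumP.
Qed.

Definition mult I : nat := projT1 (cid (interval_basis I)).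
Definition fam I : nat -> forall t, V t := projT1 (cid (projT2 (cid (interval_basis I)))).

Lemma famP I :
  [/\ forall k t, iv I t -> vP I (fam I k t),
      forall k s t, iv I s -> iv I t -> s <= t -> tr s t (fam I k s) = fam I k t,
      forall t (c : nat -> K), iv I t -> vM I (\sum_(k < mult I) c k *: fam I k t) ->
        forall k, (k < mult I)%N -> c k = 0 &
      forall t v, iv I t -> @vP I t v ->
        exists c : nat -> K, vM I (v - \sum_(k < mult I) c k *: fam I k t)].
Proof. exact: projT2 (cid (projT2 (cid (interval_basis I)))). Qed.

Definition mult_barcode : barcode R nat := [set b | (0 < b.2 <= mult b.1)%N].

(** Copies of a bar are numbered from 1 and families from 0, whence the predecessor. *)
Definition bar_vec (b : ival R * nat) t : V t := fam b.1 b.2.-1 t.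

Lemma bar_vec_vP b t : iv b.1 t -> vP b.1 (bar_vec b t).
Proof. by have [h _ _ _] := famP b.1; exact: h. Qed.

(** Gathers the terms on a single interval into the form to which the independence in [famP]
    applies; the copies of [I] missing from [s] get coefficient 0. *)
Lemma sum_fam_bars I (s : seq (ival R * nat)) (c : ival R * nat -> K) t :
  uniq s -> (forall b, b \in s -> mult_barcode b) ->
  \sum_(b <- s | b.1 == I) c b *: bar_vec b t =
  \sum_(k < mult I) (if (I, k.+1) \in s then c (I, k.+1) else 0) *: fam I k t.
Proof.
move=> us sC; pose F b := if (b.1 == I) && (b \in s) then c b *: bar_vec b t else 0.
transitivity (\sum_(b <- s) F b).
  rewrite [LHS]big_mkcond /=; apply: eq_big_seq => b bs.
  by rewrite /F bs andbT.
transitivity (\sum_(b <- [seq (I, k.+1) | k <- iota 0 (mult I)]) F b).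
  apply: eq_sum_support => // [|b].
    by rewrite map_inj_uniq ?iota_uniq// => i j [].
  rewrite /F; case: ifP => [/andP[/eqP bI bs] _|]; last by rewrite eqxx.
  rewrite bs; apply/esym/mapP; have /andP[b0 bm] := sC _ bs.
  exists b.2.-1; last by rewrite prednK// -bI; case: (b).
  by rewrite mem_iota add0n /= prednK// -bI.
rewrite big_map -[X in iota 0 X]subn0 -/(index_iota 0 _) big_mkord; apply: eq_bigr => k _.
by rewrite /F /= eqxx /=; case: ifP => // _; rewrite scale0r.
Qed.

(* Among the bars with non-zero coefficient take those born last, and of
   these one dying last: all others contribute to its [vM]. *)
Lemma bar_vec_indep t (s : seq (ival R * nat)) (c : ival R * nat -> K) :
  uniq s -> (forall b, b \in s -> mult_barcode b /\ iv b.1 t) ->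
  \sum_(b <- s) c b *: bar_vec b t = 0 -> forall b, b \in s -> c b = 0.
Proof.
move=> us sC s0 b0 b0s; apply: contrapT => /eqP cb0.
have ex0 : exists2 b, b \in s & c b != 0 by exists b0.
have [b1 [b1s cb1 b1max]] := @total_max_in _ (fun b b' => lo_le b.1 b'.1)
  (fun b => c b != 0) s (fun b b' => lo_le_total b.1 b'.1)
  (fun b b' b'' => @lo_le_trans _ b.1 b'.1 b''.1) ex0.
have ex1 : exists2 b, b \in s & c b != 0 /\ lo_le b1.1 b.1.
  by exists b1 => //; split=> //; exact: lo_le_refl.
have [b2 [b2s [cb2 lo12] b2max]] := @total_max_in _ (fun b b' => hi_le b.1 b'.1)
  (fun b => c b != 0 /\ lo_le b1.1 b.1) s (fun b b' => hi_le_total b.1 b'.1)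
  (fun b b' b'' => @hi_le_trans _ b.1 b'.1 b''.1) ex1.
have b2lo b : b \in s -> c b != 0 -> lo_le b.1 b2.1.
  by move=> bs cb; apply: lo_le_trans lo12; exact: b1max.
have {b2max} b2hi b : b \in s -> c b != 0 -> lo_le b2.1 b.1 -> hi_le b.1 b2.1.
  by move=> bs cb lb; apply: b2max => //; split=> //; exact: lo_le_trans lb.
set I := b2.1 in lo12 b2lo b2hi.
have It : iv I t by case: (sC _ b2s).
(* Every bar of the support is born no later than [I]. Within the support, [S2] collects the other
   bars with the same lower end, which die within [I], and [S3] those born strictly before [I]. *)
pose p (b : ival R * nat) := `[< lo_le I b.1 >].
pose S1 := \sum_(b <- s | b.1 == I) c b *: bar_vec b t.
pose S2 := \sum_(b <- s | (b.1 != I) && p b) c b *: bar_vec b t.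
pose S3 := \sum_(b <- s | (b.1 != I) && ~~ p b) c b *: bar_vec b t.
have sumS : S1 + (S2 + S3) = 0.
  by rewrite -s0 [RHS](bigID (fun b : ival R * nat => b.1 == I)) /= [X in _ = _ + X](bigID p).
have kerS b : b \in s -> c b != 0 -> p b -> kerP I (bar_vec b t).
  move=> bs cb /asboolP pb r rI; have [_ h] := bar_vec_vP (proj2 (sC _ bs)).
  by apply: h => x /(b2hi _ bs cb pb)[y Iy xy]; exact: le_lt_trans (rI _ Iy).
have S1k : kerP I S1.
  apply: linear_pred_sum; [exact: kerP0|exact: kerP_lin|move=> b bs /eqP bI cb].
  by apply: kerS => //; rewrite /p bI; apply/asboolP; exact: lo_le_refl.
have S2k : kerP I S2.
  apply: linear_pred_sum; [exact: kerP0|exact: kerP_lin|move=> b bs /andP[_ pb] cb].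
  exact: kerS.
have S2M : kerM I S2.
  apply: linear_pred_sum; [exact: kerM0|exact: kerM_lin|].
  move=> b bs /andP[bI /asboolP pb] cb; have [|[r Ir rb]] := hi_leP I b.1.
    move=> hb; case/eqP: bI; apply: lo_hi_eq => //; first exact: b2lo.
    exact: b2hi.
  exists r; split => //; first by apply: ltW; apply: rb; case: (sC _ bs).
  by have [_ h] := bar_vec_vP (proj2 (sC _ bs)); exact: h.
have S2P : imP I S2.
  apply: linear_pred_sum; [exact: imP0|exact: imP_lin|].
  move=> b bs _ cb r Ir rt; have [u bu ur] := b2lo b bs cb _ Ir.
  have [h _] := bar_vec_vP (proj2 (sC _ bs)).
  by apply: (tr_img ur rt); apply: h => //; exact: le_trans rt.
have S3M : imM I S3.
  apply: linear_pred_sum; [exact: imM0|exact: imM_lin|].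
  move=> b bs /andP[_ /asboolP npb] cb; have [//|[u bu uI]] := lo_leP I b.1.
  have [h _] := bar_vec_vP (proj2 (sC _ bs)).
  have ut : u <= t by exact/ltW/uI.
  by right; exists u; split => //; exact: h.
have opp1 (v : V t) : - v = -1 *: v + 0 by rewrite scaleN1r addr0.
have S1E : S1 = - S3 - S2 by rewrite -opprD [S3 + _]addrC; apply/eqP; rewrite -addr_eq0 sumS.
(* Single bars in [S3] may outlive [I], but their sum is killed beyond [I] since it is, up to sign,
   the sum of [S1] and [S2]. *)
have S3E : - S3 = 1 *: S1 + S2 by rewrite S1E scale1r subrK.
have : vM I S1.
  exists (- S3), (- S2); split; first exact: S1E.
  - by rewrite opp1; apply: imM_lin => //; exact: imM0.
  - by rewrite S3E; exact: kerP_lin.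
  - by rewrite opp1; apply: imP_lin => //; exact: imP0.
  - by rewrite opp1; apply: kerM_lin => //; exact: kerM0.
rewrite /S1 sum_fam_bars//; last by move=> b /sC[].
have [_ _ ind _] := famP I.
have /andP[b20 b2m] := proj1 (sC _ b2s).
pose c' k := if (I, k.+1) \in s then c (I, k.+1) else 0.
have b2E : (I, b2.2.-1.+1) = b2 by rewrite prednK// /I; case: (b2).
move=> /(ind _ c' It)/(_ b2.2.-1); rewrite /c' b2E b2s prednK// => /(_ b2m).
by apply/eqP.
Qed.

Local Notation C := mult_barcode.
Local Notation P := (barcode_module K C).

Lemma mult_barcode_natural : natural_barcode C.
Proof.
move=> I n /andP[/= n0 nm]; split => // m /andP[m0 mn].
by rewrite /mult_barcode /= m0 (leq_trans mn).
Qed.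

(** The vectors of distinct bars through [t] are independent, so the dimension of [V t] bounds the
    number of these bars. *)
Lemma bars_at_exist t : exists L : seq (set_type C),
  uniq L /\ forall b, (b \in L) <-> iv (val b).1 t.
Proof.
have fin : finite_set [set b : set_type C | iv (val b).1 t].
  apply: (@finite_set_uniq_bound _ _ (\dim {:V t})) => s us sC.
  pose X := map_tuple (fun b => bar_vec (val b) t) (in_tuple s).
  suff fX : free X.
    by move: fX; rewrite /free => /eqP; rewrite size_map => <-; rewrite dimvS// subvf.
  apply/freeP => k k0 i.
  pose c b := oapp k 0 (insub (index b [seq val b | b <- s])).
  have ci j : c (val (tnth (in_tuple s) j)) = k j.
    rewrite /c index_map; last exact: val_inj.
    by rewrite (tnth_nth (tnth (in_tuple s) j)) index_uniq// valK.
  rewrite -ci; apply: (@bar_vec_indep t [seq val b | b <- s]).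
  - by rewrite map_inj_uniq//; exact: val_inj.
  - by move=> _ /mapP[b bs ->]; split; [exact: set_valP|exact: sC].
  - rewrite big_map big_tnth -[RHS]k0; apply: eq_bigr => j _.
    by rewrite ci -tnth_nth tnth_map.
  - by apply: map_f; exact: mem_tnth.
have [s sE] := (finite_seqP _).1 fin.
exists (undup s); split=> [|b]; first exact: undup_uniq.
rewrite mem_undup; have -> : (b \in s) = `[< [set` s] b >] by rewrite asboolb.
by rewrite -sE; split=> [/asboolP//|?]; apply/asboolP.
Qed.

Definition bars_at t := projT1 (cid (bars_at_exist t)).

Lemma bars_at_uniq t : uniq (bars_at t).
Proof. by have [] := projT2 (cid (bars_at_exist t)). Qed.

Lemma bars_atP t b : reflect (iv (val b).1 t) (b \in bars_at t).
Proof.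
have [_ h] := projT2 (cid (bars_at_exist t)).
by apply: (iffP idP); [exact: (h b).1|exact: (h b).2].
Qed.

(* A vector [w <> 0] spans its own interval [I], between the birth and the death
   of [w].  Subtracting a combination of the bars on [I] leaves a sum of a vector
   born earlier and of one dying earlier: induct on the dimensions of the image
   and of the kernel which contain [w]. *)
Lemma bar_vec_span t v : v \in <<[seq bar_vec (val b) t | b <- bars_at t]>>%VS.
Proof.
set U := <<_>>%VS.
have dim_lt (A B : {vspace V t}) (w : V t) : (A <= B)%VS -> w \in B -> w \notin A ->
    (\dim A < \dim B)%N.
  move=> AB wB wA; rewrite ltn_neqAle dimvS// andbT.
  apply: contra wA => /eqP dAB; suff /eqP -> : A == B by [].
  by rewrite eqEdim AB dAB leqnn.
(* With [E] of this form, the kernels met in the induction are comparable by inclusion. *)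
pose kspace (E : {vspace V t}) := E = fullv \/ exists2 r, t <= r & E = lker (tr t r).
suff main n : forall s E w, s <= t -> kspace E -> w \in limg (tr s t) -> w \in E ->
    (\dim (limg (tr s t)) + \dim E < n)%N -> w \in U.
  apply: (main _ t fullv) (ltnSn _) => //; first by left.
  - by apply/tr_imgP; exists v; rewrite tr_id.
  - exact: memvf.
elim: n => // n IH s E w st Ek ws wE; rewrite ltnS => dimn.
have [->|w0] := eqVneq w 0; first exact: mem0v.
pose S := [set q | (q <= t /\ w \in limg (tr q t)) \/ (t <= q /\ tr t q w != 0)].
have St : S t by right; rewrite tr_id.
have Sle q : S q -> q <= t -> w \in limg (tr q t).
  move=> [[]//|[tq _] qt]; have -> : q = t by apply/eqP; rewrite eq_le qt.
  by apply/tr_imgP; exists w; rewrite tr_id.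
have Sge q : S q -> t <= q -> tr t q w != 0.
  move=> [[qt _] tq|[]//]; have -> : q = t by apply/eqP; rewrite eq_le qt.
  by rewrite tr_id.
have Sint x y : S x -> S y -> forall z, x <= z <= y -> S z.
  move=> Sx Sy z /andP[xz zy]; have [zt|/ltW tz] := leP z t.
    by left; split=> //; apply: (tr_img xz zt); apply: Sle => //; exact: (le_trans xz).
  right; split=> //; have := Sge _ Sy (le_trans tz zy).
  by apply: contra => /eqP wz; rewrite -(tr_comp _ tz zy) wz linear0.
pose I := Ival (ex_intro S t St) Sint.
have It : iv I t by [].
have [_ _ _ /(_ t w It)] := famP I; case.
  split=> [q Iq qt|r rI]; first exact: Sle.
  apply/eqP; apply: contrapT => /negP rw.
  have Ir : iv I r by right; split=> //; exact/ltW/rI.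
  by have := rI _ Ir; rewrite ltxx.
move=> c [a [b [wab aM aK bP [r [Ir tr_ br]]]]].
have wE' : w = \sum_(k < mult I) c k *: fam I k t + (a + b).
  by rewrite -wab addrC subrK.
rewrite wE'; apply: memvD; last apply: memvD.
- apply: memv_suml => k _; apply: memvZ; apply: memv_span.
  have Ck : (I, k.+1) \in C by apply: mem_set; rewrite /mult_barcode /= ltn_ord.
  by apply/mapP; exists (SigSub Ck) => //; apply/bars_atP.
- case: aM => [->|[s' [s't s'I as']]]; first exact: mem0v.
  have ws' : w \notin limg (tr s' t).
    by apply/negP => ws'; have := s'I s'; rewrite ltxx => /(_ (or_introl (conj s't ws'))).
  have s's : s' <= s.
    by have [//|/ltW ss'] := leP s' s; rewrite (tr_img ss' s't ws) in ws'.
  have sub : (limg (tr s' t) <= limg (tr s t))%VS.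
    by apply/subvP => x; exact: tr_img.
  apply: (IH s' E) => //.
    (* If [E] is the kernel at [q], then [w] is dead at [q], so [q] is beyond [I] and [a] is dead
       there too. *)
    case: Ek => [->|[q tq Eq]]; first exact: memvf.
    rewrite Eq memv_ker; apply/eqP/aK => x Ix.
    rewrite ltNge; apply/negP => qx; have := Sge _ Ix (le_trans tq qx).
    by move: wE; rewrite Eq memv_ker -(tr_comp _ tq qx) => /eqP ->; rewrite linear0 eqxx.
  by apply: leq_trans dimn; rewrite ltn_add2r; exact: dim_lt ws ws'.
(* As [r] is in [I], [w] is alive at [r] while [b] is dead: the kernel at [r] is a proper subspace
   of [E] containing [b]. The image from [s] still contains [b], since [s] is in [I]. *)
- have wr : w \notin lker (tr t r) by rewrite memv_ker; exact: Sge.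
  apply: (IH s (lker (tr t r))) => //.
  + by right; exists r.
  + by apply: bP => //; left.
  + by rewrite memv_ker br.
  apply: leq_trans dimn; rewrite ltn_add2l; apply: (dim_lt _ _ w) => //.
  case: Ek => [->|[q tq Eq]]; first exact: subvf.
  rewrite Eq in wE *; apply/subvP => x; rewrite !memv_ker => /eqP xr.
  have [rq|/ltW qr] := leP r q; first by rewrite -(tr_comp _ tr_ rq) xr linear0.
  by move: wr wE; rewrite !memv_ker -(tr_comp _ tq qr) => wr /eqP wq; rewrite wq linear0 eqxx in wr.
Qed.

Definition bar_sum t (x : P t) : V t :=
  \sum_(b <- bars_at t) bar_coord x b *: bar_vec (val b) t.

Lemma bar_sum_linear t : linear (@bar_sum t).
Proof.
move=> a x y; rewrite /bar_sum scaler_sumr -big_split /=; apply: eq_bigr => b _.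
by rewrite bar_coordP scalerDl scalerA.
Qed.

HB.instance Definition _ t :=
  GRing.isLinear.Build K (P t) (V t) *:%R (@bar_sum t) (@bar_sum_linear t).

(** Both sides reduce to the bars through [s] and [t]: a bar through [s] that misses [t] has ended,
    so its vector is killed, and one through [t] that misses [s] has coordinate 0 in [x]. *)
Lemma bar_sum_natural s t (h : s <= t) (x : P s) :
  bar_sum (pmap P h x) = pfd_map M h (bar_sum x).
Proof.
rewrite -trE /bar_sum linear_sum.
pose F b := if (b \in bars_at s) && (b \in bars_at t)
  then bar_coord x b *: bar_vec (val b) t else 0.
transitivity (\sum_(b <- bars_at t) F b).
  apply: eq_big_seq => b bt; rewrite /F bt andbT bar_coord_map_in; last exact/bars_atP.
  case: ifPn => // /bars_atP bs; rewrite bar_coord_out//.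
  exact: scale0r.
transitivity (\sum_(b <- bars_at s) F b).
  apply: eq_sum_support; rewrite ?bars_at_uniq// => b.
  by rewrite /F; case: (b \in bars_at s); case: (b \in bars_at t) => //=; rewrite eqxx.
apply: eq_big_seq => b bs; rewrite /F bs linearZ /=; move/bars_atP: bs => bs.
case: ifPn => /bars_atP bt.
  by have [_ h4 _ _] := famP (val b).1; rewrite /bar_vec h4.
have [_ ->] := bar_vec_vP bs; rewrite ?scaler0// => u bu.
by rewrite ltNge; apply/negP => tu; apply: bt; exact: ival_between bs bu h tu.
Qed.

Lemma bar_sum_inj t : injective (@bar_sum t).
Proof.
move=> x y xy; apply/eqP; rewrite -subr_eq0; apply/eqP.
have {xy} : bar_sum (x - y) = 0 by rewrite linearB /= xy subrr.
move: (x - y) => {x y} z z0; apply: bar_coord_inj => b; rewrite bar_coord0.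
have [bt|] := boolP (b \in bars_at t); last by move/bars_atP/bar_coord_out.
pose c (b : ival R * nat) := if insub b is Some b' then bar_coord z (b' : set_type C) else 0.
have cE b' : c (val b') = bar_coord z b' by rewrite /c valK.
rewrite -cE; apply: (@bar_vec_indep t [seq val b | b <- bars_at t]).
- by rewrite map_inj_uniq ?bars_at_uniq//; exact: val_inj.
- by move=> _ /mapP[b' /bars_atP b't ->]; split => //; exact: set_valP.
- by rewrite big_map -[RHS]z0; apply: eq_bigr => b' _; rewrite cE.
- exact: map_f.
Qed.

Lemma bar_sum_surj t (v : V t) : exists x : P t, bar_sum x = v.
Proof.
have sum1 b k : b \in bars_at t -> bar_sum (k *: bar_elt K t b) = k *: bar_vec (val b) t.
  move=> bt; rewrite linearZ /= /bar_sum (bigD1_seq b) ?bars_at_uniq//=.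
  move/bars_atP: bt => bt; rewrite bar_coord_bar_elt// eqxx scale1r big1 ?addr0// => b' /negPf bb.
  by rewrite bar_coord_bar_elt// bb scale0r.
have main (s : seq (set_type C)) w : {subset s <= bars_at t} ->
    w \in (\sum_(b <- s) <[bar_vec (val b) t]>)%VS -> exists x : P t, bar_sum x = w.
  elim: s w => [w _|b s IH w sub].
    by rewrite big_nil memv0 => /eqP ->; exists 0; rewrite linear0.
  rewrite big_cons => /memv_addP[_ /vlineP[k ->] [w' w's ->]].
  have [|x <-] := IH w' _ w's; first by move=> b' b's; apply: sub; rewrite inE b's orbT.
  exists (k *: bar_elt K t b + x); rewrite linearD /= sum1//.
  by apply: sub; rewrite mem_head.
by apply: (main (bars_at t)) => //; have := bar_vec_span v; rewrite span_def big_map.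
Qed.

Lemma structure_iso : pisomorphic M P.
Proof.
have inv t : exists g : V t -> P t, cancel g (@bar_sum t) /\ cancel (@bar_sum t) g.
  have /choice[g hg] := @bar_sum_surj t.
  by exists g; split => // x; apply: bar_sum_inj; rewrite hg.
pose g t := sval (cid (inv t)).
have gK t : cancel (g t) (@bar_sum t) by have [] := svalP (cid (inv t)).
have Kg t : cancel (@bar_sum t) (g t) by have [] := svalP (cid (inv t)).
have glin t : linear (g t) by exact: (can2_linear (Kg t) (gK t)).
pose G t : {linear V t -> P t} := HB.pack (g t)
  (GRing.isLinear.Build K (V t) (P t) *:%R (g t) (glin t)).
have gnat s t (h : s <= t) (v : V s) : G t (pfd_map M h v) = pmap P h (G s v).
  by apply: bar_sum_inj; rewrite bar_sum_natural /= !gK.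
exists (@PMorphism R K M P G gnat), (@PMorphism R K P M (fun t => @bar_sum t) bar_sum_natural).
by split => t x /=; [exact: gK|exact: Kg].
Qed.

End Structure.

(** * Transport along isomorphisms, and local finiteness of barcodes *)

Section Transport.
Variables (R : realType) (K : fieldType).
Implicit Types (M N : pmodule R K).

Lemma pisomorphic_sym M N : pisomorphic M N -> pisomorphic N M.
Proof. by move=> [f [g [fg gf]]]; exists g, f. Qed.

(** One of the two identities of an interleaving; the other follows by exchanging the roles of the
    modules. *)
Lemma half_interleaving_iso M M' N N' (d : R) (hd : 0 <= d)
    (f : pmorphism M (pshift d N)) (g : pmorphism N (pshift d M))
    (p : pmorphism M M') (p' : pmorphism M' M)
    (q : pmorphism N N') (q' : pmorphism N' N) :
  pmor_eq (pmor_comp p p') (pmor_id M') -> pmor_eq (pmor_comp q' q) (pmor_id N) ->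
  pmor_eq (pmor_comp (pshift_add M d d) (pmor_comp (pmor_shift d g) f))
    (ptransition M (addr_ge0 hd hd)) ->
  pmor_eq
    (pmor_comp (pshift_add M' d d)
      (pmor_comp (pmor_shift d (pmor_comp (pmor_shift d p) (pmor_comp g q')))
        (pmor_comp (pmor_shift d q) (pmor_comp f p'))))
    (ptransition M' (addr_ge0 hd hd)).
Proof.
move=> pp qq gf t x /=.
have /= -> := qq _ (f t (p' t x)); rewrite -pmor_natural.
by have /= -> := gf t (p' t x); rewrite pmor_natural; have /= -> := pp t x.
Qed.

Lemma pinterleaved_iso M M' N N' (d : R) : pisomorphic M M' -> pisomorphic N N' ->
  pinterleaved M N d -> pinterleaved M' N' d.
Proof.
move=> [p [p' [pp' p'p]]] [q [q' [qq' q'q]]] [hd [f [g [gf fg]]]].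
exists hd, (pmor_comp (pmor_shift d q) (pmor_comp f p')).
exists (pmor_comp (pmor_shift d p) (pmor_comp g q')).
by split; apply: half_interleaving_iso.
Qed.

Variable M : pfd_module R K.

(** [mult_barcode] shows that the described set is inhabited, so the default of [xget] is not
    taken. *)
Lemma barcode_ofP : pisomorphic M (barcode_module K (barcode_of M)).
Proof.
rewrite /barcode_of; case: xgetP => [C _ []//|/(_ (mult_barcode M))[]].
by split; [exact: mult_barcode_natural|exact: structure_iso].
Qed.

(** The isomorphism carries the basis vectors of the bars through [t] to independent vectors of the
    finite dimensional space at [t]. *)
Lemma finite_bars_at (X : choiceType) (C : barcode R X) (t : R) :
  pisomorphic M (barcode_module K C) ->
  finite_set [set b : set_type C | iv (val b).1 t].
Proof.
move=> [f [h [_ hK]]]; apply: (@finite_set_uniq_bound _ _ (\dim {: pfd_obj M t})) => s us sC.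
pose v (b : set_type C) : pfd_obj M t := h t (bar_elt K t b).
pose F := map_tuple v (in_tuple s).
suff fF : free F.
  by move: fF; rewrite /free => /eqP; rewrite size_map => <-; rewrite dimvS// subvf.
apply/freeP => k k0 i.
have k0' : \sum_(j < size s) k j *: bar_elt K t (tnth (in_tuple s) j) = 0.
  set S := LHS; have /= <- := hK t S; rewrite -[RHS](linear0 (f t)); congr (f t _).
  rewrite /S linear_sum -[RHS]k0; apply: eq_bigr => j _.
  by rewrite linearZ /= (nth_map (tnth (in_tuple s) j)) //
    [in LHS](tnth_nth (tnth (in_tuple s) j)).
have := bar_coord0 K t (tnth (in_tuple s) i); rewrite -k0' bar_coord_sum.
rewrite (bigD1 i)//= bar_coordZ bar_coord_bar_elt; last exact/sC/mem_tnth.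
rewrite eqxx mulr1 big1 ?addr0// => j ji.
rewrite bar_coordZ bar_coord_bar_elt; last exact/sC/mem_tnth.
by rewrite (inj_eq (elimT (tuple_uniqP (in_tuple s)) us)) eq_sym (negPf ji) mulr0.
Qed.

End Transport.

(** * From barcode interleavings to module interleavings *)

Lemma bar_shift_inj (R : realType) (X : Type) (d : R) : injective (@bar_shift R X d).
Proof.
move=> [I x] [J y] [IJ ->]; congr (_, _); apply: ival_eq => t.
by rewrite -[t](subrK d) -/(iv (Ival _ _) (t - d)) -/(ival_set (Ival _ _) (t - d));
  have /(congr1 (fun A : set R => A (t - d))) /= -> := IJ.
Qed.

Lemma bar_shift_add (R : realType) (X : Type) (d e : R) (b : ival R * X) :
  bar_shift e (bar_shift d b) = bar_shift (d + e) b.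
Proof.
congr (_, _); apply: ival_eq => t.
by rewrite /= -addrA [e + d]addrC.
Qed.

Lemma barcode_transition_mem (R : realType) (X : Type) (C : barcode R X) (d : R)
    (b b' : ival R * X) : barcode_transition C d (b, bar_shift d b') <->
  [/\ C b, ~ in_halfopen d b.1 & b = b'].
Proof.
split=> [[c [Cc hc] e]|[Cb hb <-]]; last by exists b.
have cb : c = b := congr1 fst e.
by have /bar_shift_inj <- : bar_shift d c = bar_shift d b' := congr1 snd e; rewrite -cb.
Qed.

(** If no two points of [I] are at distance [d], then [I] has an infimum [a], and it lies in [[a, a
    + d[] if [a] belongs to [I] and in []a, a + d]] otherwise. *)
Lemma not_in_halfopenP (R : realType) (d : R) (I : ival R) : 0 <= d ->
  ~ in_halfopen d I <-> exists2 t, iv I t & iv I (t + d).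
Proof.
move=> d0; split=> [|[t It Itd] [a [sub|sub]]]; last 2 first.
- have := sub _ It; have := sub _ Itd.
  by rewrite /= !in_itv /= => /andP[_ ?] /andP[? _]; lra.
- have := sub _ It; have := sub _ Itd.
  by rewrite /= !in_itv /= => /andP[_ ?] /andP[? _]; lra.
apply: contra_notP => h.
have {}h x y : iv I x -> iv I y -> x + d <= y -> False.
  move=> Ix Iy xy; apply: h; exists x => //.
  by apply: ival_between Ix Iy _ xy; rewrite lerDl.
have [t0 It0] := ival_nonempty I.
have lbI : has_lbound (ival_set I).
  exists (t0 - d) => y Iy; rewrite leNgt; apply/negP => yt.
  by apply: (h y t0) => //; lra.
have ge_a x : iv I x -> inf (ival_set I) <= x by move=> Ix; apply: ge_inf.
set a := inf _ in ge_a.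
exists a; have [Ia|nIa] := pselect (iv I a); [left|right] => x Ix.
  rewrite /= in_itv /= ge_a//= ltNge; apply/negP => ax.
  exact: h Ia Ix ax.
rewrite /= in_itv /= lt_neqAle ge_a// andbT; apply/andP; split.
  by apply/eqP => ax; apply: nIa; rewrite ax.
rewrite leNgt; apply/negP => ax.
have e0 : 0 < x - d - a by lra.
have [y Iy yx] := inf_adherent e0 (conj (ival_nonempty I) lbI).
by apply: (h y x) => //; move: yx; rewrite -/a; lra.
Qed.

Section MatchingMorphism.
Variables (R : realType) (K : fieldType) (X Y : choiceType).
Variables (C : barcode R X) (D : barcode R Y) (d : R) (f : bar_relation R X Y).
Hypothesis fM : overlap_matching C (barcode_shift d D) f.
Local Notation P := (barcode_module K C).
Local Notation Q := (barcode_module K D).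
Implicit Types (b : set_type C) (c : set_type D).

Lemma matching_injl b b' c : f (val b, bar_shift d (val c)) ->
  f (val b', bar_shift d (val c)) -> b = b'.
Proof. by move=> h h'; have [[_ _ inj] _] := fM; apply: val_inj; exact: inj h h'. Qed.

Lemma matching_injr b c c' : f (val b, bar_shift d (val c)) ->
  f (val b, bar_shift d (val c')) -> c = c'.
Proof.
move=> h h'; have [[_ inj _] _] := fM; apply: val_inj.
by apply: (@bar_shift_inj _ _ d); exact: inj h h'.
Qed.

(** The matching is read backwards because the induced morphism is given by coordinates: the one at
    [c] is copied from the mate of [c], or is 0 if there is none. *)
Definition mate c : option (set_type C) :=
  if pselect (exists b, f (val b, bar_shift d (val c))) is left h then Some (sval (cid h))
  else None.

Lemma mateP b c : mate c = Some b <-> f (val b, bar_shift d (val c)).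
Proof.
rewrite /mate; case: pselect => [h|h]; split=> //.
- by move=> [<-]; exact: (svalP (cid h)).
- by move=> fb; congr Some; exact: matching_injl (svalP (cid h)) fb.
- by move=> fb; case: h; exists b.
Qed.

Lemma mate_finite t (x : P t) :
  finite_set [set c | oapp (bar_coord x) 0 (mate c) <> 0].
Proof.
have : finite_set (mate @^-1` (Some @` [set b | bar_coord x b <> 0])).
  apply: finite_preimage; last by apply: finite_image; exact: bar_coord_finite.
  move=> c c' /set_mem[b _ /esym/mateP bc] _ /esym.
  rewrite ((mateP _ _).2 bc) => /mateP; exact: matching_injr bc.
apply: sub_finite_set => c /=; case: (mate c) => [b|]//= xb.
by exists b.
Qed.

Definition matching_fun t (x : P t) : Q (t + d) := dsum_of (t + d) (mate_finite x).

Lemma matching_fun_linear t : linear (@matching_fun t).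
Proof.
move=> a x y; apply: bar_coord_inj => c; rewrite bar_coordP !bar_coord_dsum_of.
case: ifP => _; last by rewrite mulr0 addr0.
by case: (mate c) => [b|] /=; rewrite ?mulr0 ?addr0// bar_coordP.
Qed.

HB.instance Definition _ t :=
  GRing.isLinear.Build K (P t) (Q (t + d)) *:%R (@matching_fun t) (@matching_fun_linear t).

Lemma matching_overlap b c : f (val b, bar_shift d (val c)) ->
  lo_le (ival_shift d (val c).1) (val b).1 /\ hi_le (ival_shift d (val c).1) (val b).1.
Proof. by move=> bc; have [_ /(_ _ _ bc)[]] := fM. Qed.

(** For matched bars [b] and [c] with [s] in [b] and [t + d] in [c], overlapping makes [t] in [b]
    equivalent to [s + d] in [c]. *)
Lemma matching_fun_natural s t (h : s <= t) (x : P s) :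
  matching_fun (pmap P h x) = pmap (pshift d Q) h (matching_fun x).
Proof.
apply: bar_coord_inj => c.
rewrite [RHS](@bar_coord_map _ _ _ D _ _ (le_shift d h)) !bar_coord_dsum_of.
case: (asboolP (iv _ (t + d))) => // ct.
case: (mate c) (fun b => (mateP b c).1) => [b /(_ b erefl) bc|]/=; last by rewrite if_same.
have [lo hi] := matching_overlap bc; rewrite /= (bar_coord_map h x b).
have [bs|bs] := pselect (iv (val b).1 s); last by rewrite bar_coord_out// !if_same.
congr (if _ then _ else _); apply/asboolP/asboolP => [bt|cs].
  have [u cu us] := lo _ bs.
  by apply: (@ival_between _ (val c).1 (u + d) _ (t + d)) => //; rewrite lerD2r.
have [u bu tu] := hi _ ct; exact: ival_between bs bu h tu.
Qed.

Definition matching_morphism : pmorphism P (pshift d Q) :=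
  @PMorphism R K P (pshift d Q) (fun t => @matching_fun t) matching_fun_natural.

End MatchingMorphism.

Lemma overlap_comp_mem (R : realType) (X Y : Type) (d : R) (f : bar_relation R X Y)
    (g : bar_relation R Y X) (b b' : ival R * X) (c : ival R * Y) :
  f (b, bar_shift d c) -> g (c, bar_shift d b') ->
  overlaps_above b.1 (ival_shift (d + d) b'.1) ->
  overlap_comp (relation_shift d g) f (b, bar_shift (d + d) b').
Proof.
move=> fbc gcb ov; split => //=; exists (bar_shift d c) => //.
by exists (c, bar_shift d b') => //=; rewrite bar_shift_add.
Qed.

Section MatchingInterleaving.
Variables (R : realType) (K : fieldType) (X Y : choiceType) (d : R).
Implicit Types (f : bar_relation R X Y) (g : bar_relation R Y X).

Lemma matching_half_interleaving (C : barcode R X) (D : barcode R Y) f g (hd : 0 <= d)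
    (fM : overlap_matching C (barcode_shift d D) f)
    (gM : overlap_matching D (barcode_shift d C) g) :
  overlap_comp (relation_shift d g) f = barcode_transition C (d + d) ->
  pmor_eq
    (pmor_comp (pshift_add (barcode_module K C) d d)
      (pmor_comp (pmor_shift d (matching_morphism K gM)) (matching_morphism K fM)))
    (ptransition (barcode_module K C) (addr_ge0 hd hd)).
Proof.
move=> gf t x; apply: bar_coord_inj => b /=.
rewrite (bar_coord_map (le_shift_add d d t)) (bar_coord_map (le_addshift (addr_ge0 hd hd) t)).
case: asboolP => // btdd; have btdd' : iv (val b).1 (t + d + d) by rewrite -addrA.
rewrite bar_coord_dsum_of asboolT//.
have [bt|bt] := pselect (iv (val b).1 t); last first.
  (* The bar [b] is not yet born at [t], so nothing may arrive in it. A contribution along [b'],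
     [c], [b] with [t] in [b'] would make [b'] overlap the shift of [b], hence put this pair into
     the composite matching and force [b' = b]. *)
  rewrite (bar_coord_out _ bt).
  case cE : (mate D d g b) => [c|]//=; move/(mateP gM): cE => cb.
  rewrite bar_coord_dsum_of; case: asboolP => // ctd.
  case b'E : (mate C d f c) => [b'|]//=; move/(mateP fM): b'E => b'c.
  apply: bar_coord_out => b't; apply: bt.
  have [flo fhi] := matching_overlap fM b'c; have [glo ghi] := matching_overlap gM cb.
  have : overlap_comp (relation_shift d g) f (val b', bar_shift (d + d) (val b)).
    apply: overlap_comp_mem b'c cb _; split; first by exists t.
      move=> s /=; rewrite addrA => /(ghi (s + d))[y cy sy].
      have /fhi[u bu yu] : iv (ival_shift d (val c).1) (y - d) by rewrite /= subrK.
      by exists u => //; apply: le_trans yu; rewrite lerBrDr.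
    move=> s /flo[u cu us]; have [v bv vu] := glo _ cu.
    exists (v - d); first by rewrite /= addrA subrK.
    by rewrite lerBlDr; apply: le_trans vu _; rewrite lerD2r.
  by rewrite gf => /barcode_transition_mem[_ _ /val_inj bb]; rewrite -bb.
(* Both [t] and [t + 2d] are in [b], so the transition matches [b] with its shift; unfolding the
   composite gives the intermediate bar [c], which contains [t + d]. *)
have : barcode_transition C (d + d) (val b, bar_shift (d + d) (val b)).
  apply/barcode_transition_mem; split => //; first exact: set_valP.
  by apply/(not_in_halfopenP _ (addr_ge0 hd hd)); exists t.
rewrite -gf => -[/= [z bz [[c w] /= cw e]] _].
have cz : bar_shift d c = z := congr1 fst e.
have wE : w = bar_shift d (val b).
  by apply: (@bar_shift_inj _ _ d); rewrite bar_shift_add; exact: (congr1 snd e).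
have Dc : c \in D by apply: mem_set; have [[sub _ _] _] := gM; have [] := sub _ cw.
pose c' : set_type D := SigSub Dc.
have {cw wE} c'b : g (val c', bar_shift d (val b)) by rewrite -wE.
have {bz cz} bc' : f (val b, bar_shift d (val c')) by rewrite cz.
have [flo _] := matching_overlap fM bc'; have [_ ghi] := matching_overlap gM c'b.
rewrite ((mateP gM _ _).2 c'b) /= bar_coord_dsum_of ((mateP fM _ _).2 bc') asboolT//=.
have [u cu ut] := flo _ bt; have [y cy ty] := ghi (t + d) btdd'.
by apply: (@ival_between _ (val c').1 (u + d) _ y) => //; rewrite lerD2r.
Qed.

End MatchingInterleaving.

Lemma pinterleaved_of_binterleaved (R : realType) (K : fieldType) (X Y : choiceType)
    (d : R) (C : barcode R X) (D : barcode R Y) : 0 <= d ->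
  binterleaved C D d -> pinterleaved (barcode_module K C) (barcode_module K D) d.
Proof.
move=> hd [f [g [fM gM gf fg]]].
exists hd, (matching_morphism K fM), (matching_morphism K gM).
by split; exact: matching_half_interleaving.
Qed.

(** * Hall's theorem and merging of injections *)

Section Hall.
Variables T U : choiceType.
Implicit Types (n m : T -> {fset U}) (A B : {fset T}).
Local Open Scope fset_scope.

Definition fnbhs n A : {fset U} := \bigcup_(a <- A) n a.

Lemma fnbhsP n A u : reflect (exists2 a, a \in A & u \in n a) (u \in fnbhs n A).
Proof.
apply: (iffP (bigfcupP _ _ _ _)) => [[a /andP[aA _] ua]|[a aA ua]]; exists a => //.
by rewrite aA.
Qed.

Definition hall_condition n := forall A, (#|` A| <= #|` fnbhs n A|)%N.

Definition refines m n := forall t, m t `<=` n t.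

(** At each [t] a member with the fewest neighbours is contained in all others of the chain, which
    gives the limit. For finite [A], the smallest of finitely many members already agrees with it on
    [A]. *)
Lemma chain_meet (F : set (T -> {fset U})) n0 : F n0 ->
  (forall m n, F m -> F n -> refines m n \/ refines n m) ->
  exists2 l, (forall n, F n -> refines l n) &
    forall A, exists2 n, F n & forall t, t \in A -> n t = l t.
Proof.
move=> Fn0 tot.
have min t : exists2 n, F n & forall m, F m -> n t `<=` m t.
  pose Q k := `[< exists2 n, F n & #|` n t| = k >].
  have exQ : exists k, Q k by exists #|` n0 t|; apply/asboolP; exists n0.
  have [k /asboolP[n Fn nk] kmin] := ex_minnP exQ.
  exists n => // m Fm; have [mn|] := tot _ _ Fm Fn; last by apply.
  have /eqP <- // : m t == n t.
  by rewrite eqEfcard mn /= nk kmin//; apply/asboolP; exists m.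
have /choice[c hc] t : exists n, F n /\ forall m, F m -> n t `<=` m t.
  by have [n ? ?] := min t; exists n.
exists (fun t => c t t) => [n Fn t|A]; first by have [_] := hc t; apply.
suff: exists2 n, F n & forall t, t \in enum_fset A -> n t = c t t by [].
elim: (enum_fset A) => [|t s0 [n Fn nA]]; first by exists n0.
have [Fc ct] := hc t.
have [m [Fm mn mc]] : exists m, [/\ F m, refines m n & refines m (c t)].
  by have [h|h] := tot _ _ Fn Fc; [exists n|exists (c t)]; split => // s; exact: fsubset_refl.
exists m => // s; rewrite in_cons => /orP[/eqP ->|sA]; apply/eqP; rewrite eqEfsubset.
  by rewrite mc (ct _ Fm).
by rewrite (proj2 (hc s) _ Fm) -nA// mn.
Qed.

Lemma fnbhs_eq n m A : (forall t, t \in A -> n t = m t) -> fnbhs n A = fnbhs m A.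
Proof.
by move=> nm; apply/fsetP => u; apply/fnbhsP/fnbhsP => -[a aA ua]; exists a;
  rewrite // ?nm// -nm.
Qed.

(* Submodularity of [#|fnbhs n _|] : removing either of two neighbours of [t]
   cannot break the condition in both cases. *)
Lemma hall_remove n t x y : hall_condition n -> x != y ->
  let rem z := (fun s => if s == t then n t `\ z else n s) in
  hall_condition (rem x) \/ hall_condition (rem y).
Proof.
move=> hn xy rem; apply: contrapT => /not_orP[].
(* A set violating the condition after the removal must contain [t]; [B] is that set without [t]. *)
have bad z : ~ hall_condition (rem z) -> exists2 B, t \notin B &
    (#|` fnbhs n B `|` (n t `\ z)| <= #|` B|)%N.
  move=> /existsNP[A /negP]; rewrite -ltnNge => hA.
  have tA : t \in A.
    apply: contraLR hA => tA; rewrite -leqNgt (@fnbhs_eq _ n) => [|s sA]; first exact: hn.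
    by rewrite /rem; case: eqP => // st; rewrite -st sA in tA.
  exists (A `\ t); first by rewrite !inE eqxx.
  move: hA; rewrite (cardfsD1 t A) tA ltnS; apply: leq_trans.
  apply/fsubset_leq_card/fsubsetP => u; rewrite in_fsetU => /orP[/fnbhsP[a]|utz].
    rewrite in_fsetD1 => /andP[at_ aA] ua; apply/fnbhsP; exists a => //.
    by rewrite /rem (negPf at_).
  by apply/fnbhsP; exists t; rewrite // /rem eqxx.
move=> /bad[B1 tB1 h1] /bad[B2 tB2 h2].
(* By inclusion-exclusion it suffices to bound union and intersection. As [x] and [y] differ, the
   union recovers all of [n t], so it has at least one element more than the union of [B1] and [B2];
   the intersection contains the neighbours of the intersection of [B1] and [B2]. *)
have := leq_add h1 h2; rewrite -cardfsUI -[X in (_ <= X)%N]cardfsUI leqNgt => /negP; apply.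
rewrite -addSn; apply: leq_add.
  apply: (@leq_trans #|` t |` (B1 `|` B2)|).
    by rewrite cardfsU1 !inE negb_or tB1 tB2.
  apply: (leq_trans (hn _)); apply/fsubset_leq_card/fsubsetP => u /fnbhsP[a].
  rewrite in_fset1U in_fsetU => /or3P[/eqP ->|aB|aB] ua; rewrite !inE.
  - rewrite ua !andbT; by have [->|] := eqVneq u x; rewrite ?xy ?orbT.
  - by have -> : u \in fnbhs n B1 by apply/fnbhsP; exists a.
  - by have -> : u \in fnbhs n B2 by [apply/fnbhsP; exists a]; rewrite ?orbT.
apply: (leq_trans (hn _)); apply/fsubset_leq_card/fsubsetP => u /fnbhsP[a].
rewrite in_fsetI => /andP[aB1 aB2] ua; rewrite !inE.
have -> : u \in fnbhs n B1 by apply/fnbhsP; exists a.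
by have -> : u \in fnbhs n B2 by apply/fnbhsP; exists a.
Qed.

(* Rado's proof: a minimal refinement satisfying Hall's condition has only
   singletons. *)
Theorem hall_infinite n : hall_condition n ->
  exists phi : T -> U, injective phi /\ forall t, phi t \in n t.
Proof.
move=> hn; pose S := {m : T -> {fset U} | hall_condition m /\ refines m n}.
(* The order is reversed, so that a maximal element is a minimal refinement. *)
pose Rel (a b : S) := `[< refines (sval b) (sval a) >].
have [| | | |mx mxmax] := @Zorn S Rel.
- by move=> a; apply/asboolP => t; exact: fsubset_refl.
- move=> a b c /asboolP ab /asboolP bc; apply/asboolP => t.
  exact: fsubset_trans (bc t) (ab t).
- move=> [a ha] [b hb] /asboolP /= ab /asboolP /= ba.
  apply: eq_exist => /=; apply/funext => t; apply/eqP.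
  by rewrite eqEfsubset ab ba.
- move=> F tot; have [[a0 Fa0]|F0] := pselect (exists a, F a); last first.
    exists (exist _ n (conj hn (fun t => fsubset_refl (n t)))) => a Fa.
    by case: F0; exists a.
  have [|m1 m2 [a Fa <-] [b Fb <-]|l lF lA] :=
    @chain_meet [set sval a | a in F] (sval a0).
  - by exists a0.
  - by have [/asboolP|/asboolP] := tot _ _ Fa Fb; [right|left].
  have hl : hall_condition l.
    move=> A; have [_ [a Fa <-] aA] := lA A; rewrite -(fnbhs_eq aA).
    by have [h _] := svalP a; exact: h.
  have ln : refines l n.
    move=> t; apply: (@fsubset_trans _ (sval a0 t)); first by apply: lF; exists a0.
    by have [_] := svalP a0; apply.
  by exists (exist _ l (conj hl ln)) => a Fa; apply/asboolP => /=; apply: lF; exists a.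
case: mx mxmax => m [hm mn] mxmax.
have msub t x y : x \in m t -> y \in m t -> x = y.
  move=> xm ym; apply/eqP; apply: contrapT => /negP xy.
  have remove z : z \in m t -> ~ hall_condition (fun s => if s == t then m t `\ z else m s).
    set m' := (fun s => _) => zm hm'.
    have m'm : refines m' m.
      by move=> s; rewrite /m'; case: eqP => [->|_]; [exact: fsubD1set|exact: fsubset_refl].
    have m'n : refines m' n by move=> s; exact: fsubset_trans (m'm s) (mn s).
    have mm' := mxmax (exist _ m' (conj hm' m'n)) (asboolT m'm).
    have := congr1 (fun k : S => z \in sval k t) mm'.
    by rewrite /= /m' eqxx zm !inE eqxx.
  by case: (hall_remove t hm xy); exact: remove.
have /choice[phi phiP] t : exists x, x \in m t.
  have := hm [fset t]; rewrite cardfs1 cardfs_gt0 => /fset0Pn[x /fnbhsP[a]].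
  by rewrite in_fset1 => /eqP -> ?; exists x.
exists phi; split => [s t st|t]; last exact: (fsubsetP (mn t)).
apply/eqP; apply: contrapT => /negP nst.
have := hm [fset s; t]; rewrite cardfs2 nst leqNgt => /negP; apply.
rewrite ltnS /= -(cardfs1 (phi s)); apply/fsubset_leq_card/fsubsetP => u /fnbhsP[a].
rewrite in_fset2 in_fset1 => /orP[/eqP ->|/eqP ->] ua; apply/eqP.
  exact: msub ua (phiP s).
by rewrite st; exact: msub ua (phiP t).
Qed.

End Hall.

(* Cantor-Bernstein for partial injections: follow [phi] on the orbits under
   [psi \o phi] of the points of [S] outside of the image of [psi], and the
   inverse of [psi] elsewhere. *)
Lemma matching_of_injections (A B : Type) (S : set A) (T : set B)
    (phi : A -> B -> Prop) (psi : B -> A -> Prop) :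
  (forall a, S a -> exists b, phi a b) -> (forall b, T b -> exists a, psi b a) ->
  (forall a b b', phi a b -> phi a b' -> b = b') ->
  (forall a a' b, phi a b -> phi a' b -> a = a') ->
  (forall b a a', psi b a -> psi b a' -> a = a') ->
  (forall b b' a, psi b a -> psi b' a -> b = b') ->
  exists sigma : A -> B -> Prop,
  [/\ forall a b, sigma a b -> phi a b \/ psi b a,
      forall a b b', sigma a b -> sigma a b' -> b = b',
      forall a a' b, sigma a b -> sigma a' b -> a = a',
      forall a, S a -> exists b, sigma a b &
      forall b, T b -> exists a, sigma a b].
Proof.
move=> phiS psiT phif phii psif psii.
pose orb := fix orb n a := if n is k.+1 then exists a' b, [/\ orb k a', phi a' b & psi b a]
                           else S a /\ forall b, ~ psi b a.
pose C a := exists n, orb n a.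
exists (fun a b => (C a /\ phi a b) \/ (~ C a /\ psi b a)); split.
- by move=> a b [[]|[]]; [left|right].
- move=> a b b' [[Ca ab]|[Ca ba]] [[Ca' ab']|[Ca' ba']] //.
    exact: phif ab ab'.
  exact: psii ba ba'.
- move=> a a' b [[[n Ca] ab]|[Ca ba]] [[[n' Ca'] ab']|[Ca' ba']] //.
  + exact: phii ab ab'.
  + by case: Ca'; exists n.+1, a, b.
  + by case: Ca; exists n'.+1, a', b.
  + exact: psif ba ba'.
- move=> a Sa; have [Ca|Ca] := pselect (C a).
    by have [b ab] := phiS a Sa; exists b; left.
  have [[b ba]|h] := pselect (exists b, psi b a); first by exists b; right.
  by case: Ca; exists 0%N; split => // b ba; apply: h; exists b.
- move=> b Tb; have [a ba] := psiT b Tb; have [Ca|Ca] := pselect (C a); last by exists a; right.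
  case: Ca => -[[_ /(_ b)]//|n [a' [b' [Ca' a'b' b'a]]]].
  by exists a'; left; split; [exists n|rewrite (psii _ _ _ ba b'a)].
Qed.

(** * End points of intervals *)

Section LexTriples.
Variable R : realType.
Local Notation R3 := (R * R * R)%type.
Implicit Types x y : R3.

Definition lex_pos x := 0 < x.1.1 \/ (x.1.1 = 0 /\ (0 < x.1.2 \/ (x.1.2 = 0 /\ 0 < x.2))).
Definition lex_nneg x := 0 < x.1.1 \/ (x.1.1 = 0 /\ (0 < x.1.2 \/ (x.1.2 = 0 /\ 0 <= x.2))).

Lemma lex_pos_nneg x : lex_pos x -> lex_nneg x.
Proof.
move=> [h|[h [h'|[h' /ltW h'']]]]; [by left|by right; split; [|left]|].
by right; split => //; right.
Qed.

Lemma lex_nnegN x : ~ lex_nneg x -> lex_pos (- x).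
Proof.
case: x => [[a b] c]; rewrite /lex_nneg /lex_pos /= => h.
have [a0|a0|a0] := ltrgt0P a; [by case: h; left|by left; lra|right; split; first lra].
have [b0|b0|b0] := ltrgt0P b; [by case: h; right; split; [|left]|by left; lra|].
right; split; first lra.
have [c0|c0] := leP 0 c; last by lra.
by case: h; right; split => //; right.
Qed.

Lemma lex_nneg_add x y : lex_nneg x -> lex_nneg y -> lex_nneg (x + y).
Proof.
case: x y => [[a b] c] [[a' b'] c']; rewrite /lex_nneg /=.
move=> [h|[h [k|[k l]]]] [h'|[h' [k'|[k' l']]]]; try by left; lra.
all: right; split; first lra.
all: try by left; lra.
all: by right; split; lra.
Qed.

Lemma lex_pos_add x y : lex_pos x -> lex_nneg y -> lex_pos (x + y).
Proof.
case: x y => [[a b] c] [[a' b'] c']; rewrite /lex_nneg /lex_pos /=.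
move=> [h|[h [k|[k l]]]] [h'|[h' [k'|[k' l']]]]; try by left; lra.
all: right; split; first lra.
all: try by left; lra.
all: by right; split; lra.
Qed.

Lemma lex_pos0 : ~ lex_pos 0.
Proof. by rewrite /lex_pos /= ltxx; move=> [|[_ [|[]]]]. Qed.

Lemma lex_nneg_total x : lex_nneg x \/ lex_nneg (- x).
Proof.
have [|/lex_nnegN/lex_pos_nneg] := pselect (lex_nneg x); [by left|by right].
Qed.

Lemma triple_eq x y : x.1.1 = y.1.1 -> x.1.2 = y.1.2 -> x.2 = y.2 -> x = y.
Proof. by case: x y => [[a b] c] [[a' b'] c'] /= -> -> ->. Qed.

End LexTriples.

(* A lower end is encoded in the lexicographically ordered group R * R * R by
   (-1, 0, 0) if it is infinite, by (0, x, 0) if it is x and is attained, and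
   by (0, x, 1) if it is x and is not attained.  Upper ends are the opposites
   of the lower ends of the opposite intervals. *)
Section Ends.
Variable R : realType.
Local Notation R3 := (R * R * R)%type.
Implicit Types I J : ival R.

Definition end_shape (e : R3) :=
  e = (-1, 0, 0) \/ exists x k, e = (0, x, k) /\ (k = 0 \/ k = 1).

Lemma lo_end_exists I : exists e : R3, end_shape e /\
  forall x, (exists2 y, iv I y & y <= x) <-> lex_nneg ((0, x, 0) - e).
Proof.
have [lb|nlb] := pselect (has_lbound (ival_set I)); last first.
  exists (-1, 0, 0); split=> [|x]; first by left.
  split=> [_|_]; first by left => /=; lra.
  apply: contrapT => h; apply: nlb; exists x => y Iy; rewrite leNgt; apply/negP => yx.
  by apply: h; exists y => //; exact: ltW.
have ge_a x : iv I x -> inf (ival_set I) <= x by move=> Ix; apply: ge_inf.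
have adh e : 0 < e -> exists2 y, iv I y & y < inf (ival_set I) + e.
  by move=> e0; exact: inf_adherent e0 (conj (ival_nonempty I) lb).
set a := inf _ in ge_a adh.
have [Ia|nIa] := pselect (iv I a).
  exists (0, a, 0); split=> [|x]; first by right; exists a, 0; split => //; left.
  rewrite /lex_nneg /= !subr0 ltxx; split=> [[y /ge_a ay yx]|].
    have [ax|ax] := ltP a x; first by right; split => //; left; lra.
    by right; split => //; right; split; lra.
  by move=> [//|[_ [h|[h _]]]]; exists a => //; lra.
exists (0, a, 1); split=> [|x]; first by right; exists a, 1; split => //; right.
rewrite /lex_nneg /= !subr0 ltxx; split=> [[y Iy yx]|].
  have ay : a < y.
    by rewrite lt_neqAle ge_a// andbT; apply/eqP => ay; apply: nIa; rewrite ay.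
  by right; split => //; left; lra.
move=> [//|[_ [h|[h h']]]]; last by lra.
have [y Iy yx] := adh _ h; exists y => //; lra.
Qed.

Definition lo_end I : R3 := sval (cid (lo_end_exists I)).

Lemma lo_end_shape I : end_shape (lo_end I).
Proof. by have [] := svalP (cid (lo_end_exists I)). Qed.

Lemma lo_endP I x : (exists2 y, iv I y & y <= x) <-> lex_nneg ((0, x, 0) - lo_end I).
Proof. by have [_] := svalP (cid (lo_end_exists I)); apply. Qed.

Lemma lo_le_lex I J (d : R) : 0 <= d -> lo_le (ival_shift d I) J ->
  lex_nneg (lo_end J - lo_end I + (0, d, 0)).
Proof.
move=> d0 IJ.
have {}IJ x : lex_nneg ((0, x, 0) - lo_end J) -> lex_nneg ((0, x + d, 0) - lo_end I).
  move=> /lo_endP[y Jy yx]; have [z Iz zy] := IJ _ Jy.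
  by apply/lo_endP; exists (z + d); [exact: Iz|lra].
case: (lo_end_shape I) IJ => [->|[z [k [-> hk]]]];
  case: (lo_end_shape J) => [->|[x [l [-> hl]]]] IJ.
- right => /=; split; first lra.
  by have [d0'|] := ltP 0 d; [left; lra|right; split; lra].
- by left => /=; lra.
- have /IJ : lex_nneg ((0, z - d - 1, 0) - (-1, 0, 0)) by left => /=; lra.
  by rewrite /lex_nneg /= => -[|[_ [|[]]]]; lra.
right => /=; split; first lra.
have [zx|xz|zx] := ltgtP z (x + d); first by left; lra.
  (* The midpoint of [x] and [z - d] is above the lower end of [J] but below that of the shifted
     [I]. *)
  have /IJ : lex_nneg ((0, (x + z - d) / 2, 0) - (0, x, l)).
    by right => /=; split; [lra|left; lra].
  by rewrite /lex_nneg /= => -[|[_ [|[]]]]; lra.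
right; split; first lra.
case: hl IJ => -> IJ; last by case: hk => ->; lra.
have /IJ : lex_nneg ((0, x, 0) - (0, x, 0)).
  by right => /=; split; [lra|right; split; lra].
by rewrite /lex_nneg /= => -[|[_ [|[]]]]; lra.
Qed.

Lemma lo_leN_lex I J (d : R) : ~ lo_le (ival_shift d I) J ->
  lex_pos (lo_end I - (0, d, 0) - lo_end J).
Proof.
move=> /existsNP[x /not_implyP[Jx h]].
have h1 : lex_nneg ((0, x, 0) - lo_end J) by apply/lo_endP; exists x.
have : ~ lex_nneg ((0, x + d, 0) - lo_end I).
  move=> /lo_endP[y Iy yx]; apply: h; exists (y - d); first by rewrite /= subrK.
  lra.
move=> /lex_nnegN/lex_pos_add/(_ h1); congr (lex_pos _).
by apply: triple_eq => /=; lra.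
Qed.

Lemma ival_opp_nonempty I : [set t | ival_set I (- t)] !=set0.
Proof. by have [t It] := ival_nonempty I; exists (- t); rewrite /= opprK. Qed.

Lemma ival_opp_interval I : forall x y, [set t | ival_set I (- t)] x ->
  [set t | ival_set I (- t)] y -> forall z, x <= z <= y -> [set t | ival_set I (- t)] z.
Proof.
move=> x y /= Ix Iy z /andP[xz zy].
by apply: (ival_interval Iy Ix); rewrite !lerN2 xz zy.
Qed.

Definition ival_opp I := Ival (ival_opp_nonempty I) (@ival_opp_interval I).

Definition hi_end I : R3 := - lo_end (ival_opp I).

Lemma hi_le_opp I J (d : R) :
  hi_le (ival_shift d I) J <-> lo_le (ival_shift d (ival_opp J)) (ival_opp I).
Proof.
split=> IJ x /= Ix.
  have [|y Jy xy] := IJ (- x - d); first by rewrite /= subrK.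
  by exists (- y - d); rewrite /= ?subrK ?opprK//; lra.
have [|y Jy xy] := IJ (- (x + d)); first by rewrite /= opprK.
by exists (- (y + d)) => //; lra.
Qed.

Lemma hi_le_lex I J (d : R) : 0 <= d -> hi_le (ival_shift d I) J ->
  lex_nneg (hi_end J - hi_end I + (0, d, 0)).
Proof. by move=> d0 /hi_le_opp/(lo_le_lex d0); rewrite /hi_end opprK [- _ + _]addrC. Qed.

Lemma hi_leN_lex I J (d : R) : ~ hi_le (ival_shift d I) J ->
  lex_pos (hi_end I - (0, d, 0) - hi_end J).
Proof.
move=> h; have /lo_leN_lex : ~ lo_le (ival_shift d (ival_opp J)) (ival_opp I).
  by move/hi_le_opp.
by rewrite /hi_end opprK; congr (lex_pos _); rewrite addrAC [in RHS]addrC addrA addrAC.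
Qed.

(** Twice the centre of a bounded interval, refined by whether the ends are attained. *)
Definition ends_sum I : R3 := lo_end I + hi_end I.
Definition ends_sum_le I J := lex_nneg (ends_sum J - ends_sum I).

Lemma ends_sum_le_total I J : ends_sum_le I J \/ ends_sum_le J I.
Proof. by rewrite /ends_sum_le -[ends_sum I - _]opprB; exact: lex_nneg_total. Qed.

Lemma ends_sum_le_trans I J L : ends_sum_le I J -> ends_sum_le J L -> ends_sum_le I L.
Proof. by move=> IJ /lex_nneg_add/(_ IJ); rewrite /ends_sum_le addrA subrK. Qed.

(** Corresponding ends are at distance at most [d]; at distance exactly [d], it matters which of
    them are attained. *)
Definition close (d : R) I J := [/\ lo_le (ival_shift d J) I, hi_le (ival_shift d J) I,
  lo_le (ival_shift d I) J & hi_le (ival_shift d I) J].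

Lemma close_sym d I J : close d I J -> close d J I.
Proof. by case. Qed.

Definition long (d : R) I := exists2 t, iv I t & iv I (t + d + d).

Lemma close_long d I J t : close d I J -> iv I t -> iv I (t + d + d) -> iv J (t + d).
Proof.
move=> [lo _ _ hi] It Itdd; have [u Ju ut] := lo _ It.
have [v Jv tv] := hi (t + d) Itdd.
by apply: (@ival_between _ J (u + d) _ v) => //; rewrite lerD2r.
Qed.

Lemma ival_shift0 I : ival_shift 0 I = I.
Proof. by apply: ival_eq => x; rewrite /= addr0. Qed.

Section Between.
Variables (d : R) (I J L : ival R).
Hypothesis d0 : 0 <= d.
Hypotheses (JI_lo : lo_le (ival_shift d J) I) (JI_hi : hi_le (ival_shift d J) I).
Hypotheses (LJ_lo : lo_le (ival_shift d L) J) (LJ_hi : hi_le (ival_shift d L) J).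
Hypothesis IL : ends_sum_le I L.

(* Adding up the inequalities expressing the hypotheses and the failure of both
   conclusions gives 0 < 0. *)
Lemma close_of_between : close d I J \/ close d L J.
Proof.
have a1 := lo_le_lex d0 JI_lo; have a2 := hi_le_lex d0 JI_hi.
have a3 := lo_le_lex d0 LJ_lo; have a4 := hi_le_lex d0 LJ_hi.
apply: contrapT => /not_orP[nIJ nLJ].
have {}nIJ : ~ lo_le (ival_shift d I) J \/ ~ hi_le (ival_shift d I) J.
  by apply/not_andP => -[? ?]; apply: nIJ.
have {}nLJ : ~ lo_le (ival_shift d J) L \/ ~ hi_le (ival_shift d J) L.
  by apply/not_andP => -[? ?]; apply: nLJ.
move: IL; rewrite /ends_sum_le /ends_sum => il.
case: nIJ nLJ => [/lo_leN_lex p|/hi_leN_lex p] [/lo_leN_lex q|/hi_leN_lex q].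
- have := lex_pos_add (lex_pos_add p (lex_pos_nneg q)) (lex_nneg_add il (lex_nneg_add a2 a4)).
  rewrite (_ : _ + _ = 0); first exact: lex_pos0.
  by apply: triple_eq => /=; lra.
- have := lex_pos_add (lex_pos_add p (lex_pos_nneg q)) (lex_nneg_add il (lex_nneg_add a2 a3)).
  rewrite (_ : _ + _ = 0); first exact: lex_pos0.
  by apply: triple_eq => /=; lra.
- have := lex_pos_add (lex_pos_add p (lex_pos_nneg q)) (lex_nneg_add il (lex_nneg_add a1 a4)).
  rewrite (_ : _ + _ = 0); first exact: lex_pos0.
  by apply: triple_eq => /=; lra.
- have := lex_pos_add (lex_pos_add p (lex_pos_nneg q)) (lex_nneg_add il (lex_nneg_add a1 a3)).
  rewrite (_ : _ + _ = 0); first exact: lex_pos0.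
  by apply: triple_eq => /=; lra.
Qed.

(** Provides an index at which the matrix entry from [I] to [L] can be computed. Without one, both
    ends of [I] would lie strictly beyond those of [L], against the order of the sums of ends. *)
Lemma between_meet : long d I -> long d L ->
  exists2 t, iv I t & iv L (t + d + d).
Proof.
move=> [t It Itdd] [s Ls Lsdd]; apply: contrapT => h.
have lo x : iv I x -> exists2 y, iv L (y + d + d) & y <= x.
  move=> /JI_lo[u Ju ux]; have [v Lv vu] := LJ_lo Ju.
  by exists (v - d); rewrite ?subrK//; lra.
have hi x : iv L (x + d + d) -> exists2 y, iv I y & x <= y.
  move=> /(LJ_hi (x := x + d))[u Ju xu].
  have [|v Iv uv] := JI_hi (x := u - d); first by rewrite /= subrK.
  by exists v => //; lra.
have nhi : ~ hi_le (ival_shift 0 I) L.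
  rewrite ival_shift0 => IL_hi; apply: h; exists t => //.
  have [y Ly yt] := lo _ It; have [z Lz tz] := IL_hi _ Itdd.
  by apply: (ival_between Ly Lz); lra.
have nlo : ~ lo_le (ival_shift 0 I) L.
  rewrite ival_shift0 => IL_lo; apply: h; exists s => //.
  have [y Iy ys] := IL_lo _ Ls; have [z Iz sz] := hi _ Lsdd.
  exact: ival_between Iy Iz ys sz.
have := lex_pos_add (lo_leN_lex nlo) (lex_nneg_add (lex_pos_nneg (hi_leN_lex nhi)) IL).
rewrite (_ : _ + _ = 0); first exact: lex_pos0.
by rewrite /ends_sum; apply: triple_eq => /=; lra.
Qed.

End Between.
End Ends.

(** * From module interleavings to barcode interleavings *)

(* On the intersection of [b] and of the shift of [c], the matrix entry of [f] at
   (b, c) does not depend on the index; it is 0 if that intersection is empty. *)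
Section Coefficients.
Variables (R : realType) (K : fieldType) (X Y : choiceType).
Variables (C : barcode R X) (D : barcode R Y) (d : R).
Local Notation P := (barcode_module K C).
Local Notation Q := (barcode_module K D).
Variable f : pmorphism P (pshift d Q).
Implicit Types (b : set_type C) (c : set_type D).

Definition coef_at t b c : K := bar_coord (f t (bar_elt K t b) : Q (t + d)) c.

Lemma coef_at_le s t b c : s <= t -> iv (val b).1 s -> iv (val b).1 t ->
  iv (val c).1 (t + d) -> coef_at t b c = coef_at s b c.
Proof.
move=> st bs bt ct; rewrite /coef_at -(bar_elt_map K st bs bt) pmor_natural.
exact: (@bar_coord_map_in _ _ _ D _ _ (le_shift d st)).
Qed.

Definition coef b c : K :=
  if pselect (exists t, iv (val b).1 t /\ iv (val c).1 (t + d)) is left h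
  then coef_at (sval (cid h)) b c else 0.

Lemma coefE t b c : iv (val b).1 t -> iv (val c).1 (t + d) -> coef_at t b c = coef b c.
Proof.
move=> bt ct; rewrite /coef; case: pselect => [h|[]]; last by exists t.
case: (cid h) => s /= [bs cs].
by have [st|/ltW ts] := leP s t; [exact: coef_at_le|symmetry; exact: coef_at_le].
Qed.

(** Going down along [b], the entry would vanish on leaving [c] although it is constant. Going up,
    the vector of [b] becomes 0 once [b] ends, so by naturality [c] cannot outlast it. *)
Lemma coef_neq0 b c : coef b c != 0 ->
  lo_le (ival_shift d (val c).1) (val b).1 /\ hi_le (ival_shift d (val c).1) (val b).1.
Proof.
rewrite {1}/coef; case: pselect => [h|_]; last by rewrite eqxx.
case: (cid h) => t /= [bt ct] ft; split=> u bu.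
  have [tu|/ltW ut] := leP t u; first by exists t.
  have [cu|cu] := pselect (iv (val c).1 (u + d)); first by exists u.
  move: ft; rewrite (coef_at_le ut)// /coef_at bar_coord_out ?eqxx//.
have [ut|/ltW tu] := leP u t; first by exists t.
have [bu'|bu'] := pselect (iv (val b).1 u); first by exists u.
have := pmor_natural f tu (bar_elt K t b); rewrite bar_elt_map0// linear0.
move=> /(congr1 (fun x : Q (u + d) => bar_coord x c)); rewrite bar_coord0.
rewrite (@bar_coord_map_in _ _ _ D _ _ (le_shift d tu))// => /esym/eqP.
by rewrite (negPf ft).
Qed.

End Coefficients.

(** * Unitriangularity and Hall's condition for long bars *)

Section Stability.
Variables (R : realType) (K : fieldType) (X Y : choiceType).
Variables (C : barcode R X) (D : barcode R Y) (d : R) (hd : 0 <= d).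
Local Notation P := (barcode_module K C).
Local Notation Q := (barcode_module K D).
Variables (f : pmorphism P (pshift d Q)) (g : pmorphism Q (pshift d P)).
Hypothesis gf : pmor_eq (pmor_comp (pshift_add P d d) (pmor_comp (pmor_shift d g) f))
  (ptransition P (addr_ge0 hd hd)).
Hypothesis finD : forall t, finite_set [set c : set_type D | iv (val c).1 t].
Implicit Types (b : set_type C) (c : set_type D).

(** An entry of the matrix of the composite, which is an internal map. A non-zero product makes [c]
    overlap on both sides, so [c] contains [t + d] and occurs in the image of the basis vector of
    [b]. *)
Lemma coef_comp b b' t (N : seq (set_type D)) : uniq N ->
  iv (val b).1 t -> iv (val b').1 (t + d + d) ->
  (forall c, coef f b c * coef g c b' != 0 -> c \in N) ->
  \sum_(c <- N) coef f b c * coef g c b' = (b' == b)%:R.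
Proof.
move=> uN bt b't hN; pose y : Q (t + d) := f t (bar_elt K t b).
have [s sE] := (finite_seqP _).1 (bar_coord_finite y).
have sP c : bar_coord y c != 0 -> c \in undup s.
  by move=> /eqP yc; rewrite mem_undup; have : [set` s] c by rewrite -sE.
have sN c : c \in undup s -> bar_coord y c != 0.
  by rewrite mem_undup => cs; apply/eqP; have : [set` s] c by []; rewrite -sE.
have b't2 : iv (val b').1 (t + (d + d)) by rewrite addrA.
have := gf (bar_elt K t b) => /(congr1 (fun x : P (t + (d + d)) => bar_coord x b')) /=.
rewrite (bar_coord_map_in (le_shift_add d d t))//.
rewrite (bar_coord_map_in (le_addshift (addr_ge0 hd hd) t))//.
rewrite bar_coord_bar_elt// => <-; rewrite -/y (bar_coord_sum_bars (undup_uniq s) sP).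
rewrite linear_sum (@bar_coord_sum _ _ _ C (t + d + d)).
transitivity (\sum_(c <- undup s) coef f b c * coef g c b').
  apply: eq_sum_support => //; first exact: undup_uniq.
  move=> c fg; rewrite (hN _ fg); apply/esym/sP.
  move: fg; rewrite mulf_eq0 negb_or => /andP[fc gc].
  have [flo _] := coef_neq0 fc; have [_ ghi] := coef_neq0 gc.
  have [u cu ut] := flo _ bt; have [v cv tv] := ghi (t + d) b't.
  rewrite /y -/(coef_at f t b c) coefE//.
  by apply: (@ival_between _ (val c).1 (u + d) _ v) => //; rewrite lerD2r.
apply: eq_big_seq => c /sN yc; rewrite linearZ (@bar_coordZ _ _ _ C (t + d + d)).
have ct : iv (val c).1 (t + d) by apply: contrapT => /(bar_coord_out y)/eqP; exact/negP.
by rewrite -(coefE f bt ct) -(coefE g ct b't).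
Qed.

Definition long_bars := [set b : set_type C | long d (val b).1].

(** Requiring [b] to be long makes this set finite for every [b]: by [close_long] all its members
    pass through one common index. *)
Definition close_bars b : {fset set_type D} :=
  fset_set [set c : set_type D | long d (val b).1 /\ close d (val b).1 (val c).1].

Lemma close_barsP b c : reflect (long d (val b).1 /\ close d (val b).1 (val c).1)
  (c \in close_bars b).
Proof.
have fin : finite_set [set c : set_type D | long d (val b).1 /\ close d (val b).1 (val c).1].
  have [[t bt btdd]|nb] := pselect (long d (val b).1).
    apply: sub_finite_set (finD (t + d)) => c' /= [_ cl].
    exact: close_long cl bt btdd.
  by apply: (sub_finite_set _ (finite_set0 _)) => c' /= [].
by apply: (iffP idP); rewrite in_fset_set//; [exact: set_mem|exact: mem_set].
Qed.

(* With too few neighbours, some non-zero row vector [u] is killed by the matrix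
   of [f]; testing [u] on the bar of its support with the largest sum of ends
   contradicts unitriangularity. *)
Lemma long_bars_hall :
  hall_condition (fun b : set_type long_bars => close_bars (val b)).
Proof.
move=> A; rewrite leqNgt; apply/negP; set N := fnbhs _ A => NA.
pose sA := in_tuple (enum_fset A); pose sN := in_tuple (enum_fset N).
pose F : 'M[K]_(size (enum_fset A), size (enum_fset N)) :=
  \matrix_(i, j) coef f (val (tnth sA i)) (tnth sN j).
have : kermx F != 0.
  rewrite kermx_eq0 /row_free neq_ltn (leq_ltn_trans (rank_leq_col F))//.
move=> /rowV0Pn[u /sub_kermxP uF u0].
have /existsP[i0 ui0] : [exists i, u 0 i != 0].
  apply: contraNT u0 => /existsPn u0; apply/eqP/rowP => i.
  by rewrite mxE; apply/eqP/negPn; exact: u0.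
pose bar i := val (tnth sA i).
have ex0 : exists2 i, i \in enum 'I_(size (enum_fset A)) & u 0 i != 0.
  by exists i0; rewrite ?mem_enum.
have [i1 [_ ui1 i1max]] := @total_max_in _
  (fun i j => ends_sum_le (val (bar i)).1 (val (bar j)).1) (fun i => u 0 i != 0) _
  (fun i j => ends_sum_le_total _ _) (fun i j k => @ends_sum_le_trans _ _ _ _) ex0.
have barL i : long d (val (bar i)).1 by exact: set_valP (tnth sA i).
have barN i c : close d (val (bar i)).1 (val c).1 -> c \in N.
  move=> cl; apply/fnbhsP; exists (tnth sA i); [exact: mem_tnth|].
  by apply/close_barsP; split=> //; exact: barL.
have inner i : u 0 i != 0 -> \sum_(c <- enum_fset N) coef f (bar i) c * coef g c (bar i1) =
    (bar i1 == bar i)%:R.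
  move=> ui; have btw c : coef f (bar i) c * coef g c (bar i1) != 0 ->
      c \in N /\ exists2 t, iv (val (bar i)).1 t & iv (val (bar i1)).1 (t + d + d).
    rewrite mulf_eq0 negb_or => /andP[/coef_neq0[flo fhi] /coef_neq0[glo ghi]].
    have mii : ends_sum_le (val (bar i)).1 (val (bar i1)).1.
      by apply: i1max => //; rewrite mem_enum.
    split; last exact: (between_meet flo fhi glo ghi mii (barL i) (barL i1)).
    by case: (close_of_between hd flo fhi glo ghi mii); exact: barN.
  (* Without a common index all products vanish, and the two bars differ because a long bar meets
     its own shift. *)
  have [[t bt b't]|not] := pselect (exists2 t, iv (val (bar i)).1 t &
      iv (val (bar i1)).1 (t + d + d)).
    apply: (coef_comp _ bt b't) => [|c /btw[]//].
    exact: fset_uniq.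
  rewrite big1 => [|c _]; last by apply: contra_notP not => /eqP/btw[].
  case: eqP => // ii; case: not; rewrite ii; exact: barL.
have := congr1 (fun v : 'rV_(size (enum_fset N)) =>
  \sum_j v 0 j * coef g (tnth sN j) (bar i1)) uF.
rewrite [RHS]big1 => [|j _]; last by rewrite mxE mul0r.
under eq_bigr do rewrite mxE mulr_suml.
rewrite exchange_big /= => sum0; case/eqP: ui1; rewrite -[RHS]sum0.
have innerE i : \sum_j u 0 i * F i j * coef g (tnth sN j) (bar i1) =
    u 0 i * (bar i1 == bar i)%:R.
  have [->|ui] := eqVneq (u 0 i) 0; first by rewrite mul0r big1// => j _; rewrite !mul0r.
  rewrite -(inner i ui) [in RHS]big_tnth mulr_sumr; apply: eq_bigr => j _.
  by rewrite mxE mulrA.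
under eq_bigr do rewrite innerE.
rewrite (bigD1 i1)//= eqxx mulr1 big1 ?addr0// => i ii1.
rewrite (_ : bar i1 == bar i = false) ?mulr0//; apply: contraNF ii1 => /eqP/val_inj.
by move=> /(elimT (tuple_uniqP sA) (fset_uniq A)) ->.
Qed.

Lemma long_bars_injection : exists phi : set_type long_bars -> set_type D,
  injective phi /\ forall b : set_type long_bars, close d (val (val b)).1 (val (phi b)).1.
Proof.
have [phi [phi_inj phiP]] := hall_infinite long_bars_hall.
by exists phi; split => // b; have /close_barsP[] := phiP b.
Qed.

End Stability.

(** * Interleavings from matchings of close bars *)

Section BarcodeInterleaving.
Variables (R : realType) (X Y : Type) (C : barcode R X) (D : barcode R Y) (d : R).
Variable sigma : ival R * X -> ival R * Y -> Prop.

(** Short close bars may fail to meet after the shift, so only the overlapping pairs of [sigma] are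
    kept. *)
Definition relation_of_matching : bar_relation R X Y :=
  [set p | exists b c, [/\ p = (b, bar_shift d c), C b, D c, sigma b c &
    overlaps_above b.1 (ival_shift d c.1)]].

Lemma relation_of_matchingP b c : relation_of_matching (b, bar_shift d c) <->
  [/\ C b, D c, sigma b c & overlaps_above b.1 (ival_shift d c.1)].
Proof.
split=> [[b' [c' [e Cb Dc bc ov]]]|[Cb Dc bc ov]]; last by exists b, c.
have bb : b = b' := congr1 fst e.
have /bar_shift_inj cc : bar_shift d c = bar_shift d c' := congr1 snd e.
by rewrite bb cc.
Qed.

Lemma relation_of_matching_overlap :
  (forall b c c', sigma b c -> sigma b c' -> c = c') ->
  (forall b b' c, sigma b c -> sigma b' c -> b = b') ->
  overlap_matching C (barcode_shift d D) relation_of_matching.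
Proof.
move=> sr sl; split; first split.
- by move=> _ [b [c [-> Cb Dc _ _]]]; split => //; exists c.
- move=> b z z' [b1 [c [e _ _ bc _]]] [b2 [c' [e' _ _ bc' _]]].
  have bb : b = b1 := congr1 fst e; have bb' : b = b2 := congr1 fst e'.
  have -> : z = bar_shift d c := congr1 snd e.
  have -> : z' = bar_shift d c' := congr1 snd e'.
  by congr bar_shift; apply: sr bc _; rewrite -bb bb'.
- move=> b b' z [b1 [c [e _ _ bc _]]] [b2 [c' [e' _ _ bc' _]]].
  have -> : b = b1 := congr1 fst e; have -> : b' = b2 := congr1 fst e'.
  have zc : z = bar_shift d c := congr1 snd e.
  have zc' : z = bar_shift d c' := congr1 snd e'.
  have cc : c = c' by apply: (@bar_shift_inj _ _ d); rewrite -zc.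
  by apply: sl bc _; rewrite cc.
- move=> b z [b1 [c [e _ _ _ ov]]].
  have -> : b = b1 := congr1 fst e.
  by have -> : z = bar_shift d c := congr1 snd e.
Qed.

End BarcodeInterleaving.

(** Injectivity brings a composite pair back to the same bar, which meets its shift by [2d] and so
    is in the transition. Conversely a long bar with points [t] and [t + 2d] has a close partner
    containing [t + d], so all the pairs involved overlap. *)
Lemma relation_of_matching_comp (R : realType) (X Y : Type) (C : barcode R X)
    (D : barcode R Y) (d : R) (sigma : ival R * X -> ival R * Y -> Prop) :
  0 <= d ->
  (forall b c, sigma b c -> close d b.1 c.1) ->
  (forall b b' c, sigma b c -> sigma b' c -> b = b') ->
  (forall b, C b -> long d b.1 -> exists2 c, D c & sigma b c) ->
  overlap_comp (relation_shift d (relation_of_matching D C d (fun c b => sigma b c)))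
    (relation_of_matching C D d sigma) = barcode_transition C (d + d).
Proof.
move=> d0 scl sl sC; apply/seteqP; split.
  move=> [b z] [/= [w [b1 [c [e Cb Dc bc ov]]]]].
  move=> [[c' w'] /= [c1 [b2 [e1 Dc1 Cb2 b2c1 ov1]]] e2] ovbz.
  have bb : b = b1 := congr1 fst e.
  have wE : w = bar_shift d c := congr1 snd e.
  have c1E : c' = c1 := congr1 fst e1.
  have w'E : w' = bar_shift d b2 := congr1 snd e1.
  have w2 : bar_shift d c' = w := congr1 fst e2.
  have zE : bar_shift d w' = z := congr1 snd e2.
  have cc : c1 = c by apply: (@bar_shift_inj _ _ d); rewrite -c1E w2 wE.
  have b21 : b2 = b1 by apply: sl b2c1 _; rewrite cc.
  have {}zE : z = bar_shift (d + d) b by rewrite -zE w'E bar_shift_add b21 bb.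
  rewrite zE in ovbz *; apply/barcode_transition_mem; split => //; first by rewrite bb.
  by apply/(not_in_halfopenP _ (addr_ge0 d0 d0)); case: ovbz => -[t [bt btd] _ _]; exists t.
move=> [b z] [b1 [Cb /(not_in_halfopenP _ (addr_ge0 d0 d0))[t bt btdd]] e].
have -> : b = b1 := esym (congr1 fst e).
have -> : z = bar_shift (d + d) b1 := esym (congr1 snd e).
rewrite addrA in btdd; have [|c Dc bc] := sC _ Cb; first by exists t.
have cl := scl _ _ bc; have ctd := close_long cl bt btdd.
have [clo chi blo bhi] := cl.
apply: (@overlap_comp_mem _ _ _ _ _ _ _ _ c).
- by apply/relation_of_matchingP; split => //; split => //; exists t.
- by apply/relation_of_matchingP; split => //; split => //; exists (t + d).
- split; first by exists t; split => //=; rewrite addrA.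
    by move=> s bs; exists (s + (d + d)) => //; rewrite lerDl addr_ge0.
  move=> s bs; exists (s - (d + d)); first by rewrite /= subrK.
  by rewrite lerBlDr lerDl addr_ge0.
Qed.

Lemma binterleaved_of_pinterleaved (R : realType) (K : fieldType) (X Y : choiceType)
    (C : barcode R X) (D : barcode R Y) (d : R) :
  (forall t, finite_set [set b : set_type C | iv (val b).1 t]) ->
  (forall t, finite_set [set c : set_type D | iv (val c).1 t]) ->
  pinterleaved (barcode_module K C) (barcode_module K D) d -> binterleaved C D d.
Proof.
move=> finC finD [d0 [f [g [gf fg]]]].
have [phi [phi_inj phiP]] := long_bars_injection gf finD.
have [psi [psi_inj psiP]] := long_bars_injection fg finC.
pose phi' (b : ival R * X) (c : ival R * Y) :=
  exists b' : set_type (@long_bars _ _ C d), b = val (val b') /\ c = val (phi b').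
pose psi' (c : ival R * Y) (b : ival R * X) :=
  exists c' : set_type (@long_bars _ _ D d), c = val (val c') /\ b = val (psi c').
have [| | | | | |sigma [s_or sr sl sC sD]] :=
  @matching_of_injections _ _ [set b | C b /\ long d b.1] [set c | D c /\ long d c.1] phi' psi'.
- move=> b [/mem_set Cb lb].
  have lb' : (SigSub Cb : set_type C) \in @long_bars _ _ C d by exact: mem_set.
  by exists (val (phi (SigSub lb'))), (SigSub lb').
- move=> c [/mem_set Dc lc].
  have lc' : (SigSub Dc : set_type D) \in @long_bars _ _ D d by exact: mem_set.
  by exists (val (psi (SigSub lc'))), (SigSub lc').
- by move=> b c c' [b1 [-> ->]] [b2 [/val_inj/val_inj -> ->]].
- by move=> b b' c [b1 [-> ->]] [b2 [-> /val_inj/phi_inj ->]].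
- by move=> c b b' [c1 [-> ->]] [c2 [/val_inj/val_inj -> ->]].
- by move=> c c' b [c1 [-> ->]] [c2 [-> /val_inj/psi_inj ->]].
have scl b c : sigma b c -> close d b.1 c.1.
  by move=> /s_or[[b' [-> ->]]|[c' [-> ->]]]; [exact: phiP|exact/close_sym/psiP].
have smem b c : sigma b c -> C b /\ D c.
  by move=> /s_or[[b' [-> ->]]|[c' [-> ->]]]; split; exact: set_valP.
exists (relation_of_matching C D d sigma), (relation_of_matching D C d (fun c b => sigma b c)).
split.
- exact: relation_of_matching_overlap.
- by apply: relation_of_matching_overlap => [c b b'|c c' b]; [exact: sl|exact: sr].
- apply: relation_of_matching_comp => // b Cb lb.
  by have [c bc] := sC b (conj Cb lb); exists c => //; case: (smem _ _ bc).
- apply: (@relation_of_matching_comp _ _ _ D C d (fun c b => sigma b c)) => //.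
  + by move=> c b /scl/close_sym.
  + by move=> c c' b; exact: sr.
  + by move=> c Dc lc; have [b bc] := sD c (conj Dc lc); exists b => //; case: (smem _ _ bc).
Qed.

Theorem theorem1p7 (R : realType) (K : fieldType) (M N : pfd_module R K) :
  (forall delta : R, 0 <= delta ->
     (pinterleaved M N delta <->
      binterleaved (barcode_of M) (barcode_of N) delta)) /\
  pdist M N = bdist (barcode_of M) (barcode_of N).
Proof.
have isoM := barcode_ofP M; have isoN := barcode_ofP N.
have main (delta : R) : 0 <= delta ->
    (pinterleaved M N delta <-> binterleaved (barcode_of M) (barcode_of N) delta).
  move=> d0; split=> [MN|BMN].
    apply: (@binterleaved_of_pinterleaved _ K).
    - by move=> t; exact: finite_bars_at isoM.
    - by move=> t; exact: finite_bars_at isoN.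
    - exact: pinterleaved_iso isoM isoN MN.
  apply: (pinterleaved_iso (pisomorphic_sym isoM) (pisomorphic_sym isoN)).
  exact: pinterleaved_of_binterleaved.
split; first exact: main.
have E : [set d : R | 0 <= d /\ pinterleaved M N d] =
    [set d : R | 0 <= d /\ binterleaved (barcode_of M) (barcode_of N) d].
  by apply/seteqP; split => d /= [d0 dI]; split => //; exact/main.
by rewrite /pdist /bdist E.
Qed.
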